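(* Let $\{X_n\}_{n\in\mathbb{Z}}$ be compact metric spaces, $\{L_n\colon C(X_n)\to C(X_{n+1})\}_{n\in\mathbb{Z}}$ bounded linear operators, and $\{\Lambda_n\subset C_n^+\subset C(X_n)\}_{n\in\mathbb{Z}}$ closed convex cones such that conditions (C1), (C2), (C3) of the context are satisfied. Then the following hold. [A] For every $n\in\mathbb{Z}$ and every sequence of measures $\{\sigma_\ell\in M(X_\ell)\}_{\ell\ge n}$, the limits $$\lambda_n=\lim_{k\to\infty}\frac{\langle \mathbf{L}_n^k\mathbf{1},\sigma_{n+k}\rangle}{\langle \mathbf{L}_{n+1}^{k-1}\mathbf{1},\sigma_{n+k}\rangle},\qquad m_n=\lim_{k\to\infty}\frac{(\mathbf{L}_n^k)^*\sigma_{n+k}}{\langle \mathbf{1},(\mathbf{L}_n^k)^*\sigma_{n+k}\rangle}$$ exist (the second in the weak* topology on $M(X_n)$) and are independent of the choice of $\{\sigma_\ell\}$. [B] Each real number $\lambda_n$ is positive, each $m_n$ is a probability measure, and $L_n^*m_{n+1}=\lambda_nm_n$. [C] $(m_n)_{n\in\mathbb{Z}}$ is the unique sequence of Borel probability measures $m_n\in M(X_n)$ such that $L_n^*m_{n+1}$ is a scalar multiple of $m_n$ for every $n\in\mathbb{Z}$. [D] There are $C_1>0$ and $\gamma\in(0,1)$ such that for any $n\in\mathbb{Z}$, $k\ge\tau$, $\sigma\in M(X_{n+k})$, and $f\in\Lambda_n$, $$\Big|\log\lambda_n-\log\frac{\langle \mathbf{L}_n^k\mathbf{1},\sigma\rangle}{\langle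 \mathbf{L}_{n+1}^{k-1}\mathbf{1},\sigma\rangle}\Big|\le C_1\gamma^k\quad\text{and}\quad \Big|\langle f,m_n\rangle-\frac{\langle f,(\mathbf{L}_n^k)^*\sigma\rangle}{\langle\mathbf{1},(\mathbf{L}_n^k)^*\sigma\rangle}\Big|\le C_1\|f\|\gamma^k.$$ [E] With $\boldsymbol{\lambda}_n^k=\prod_{j=0}^{k-1}\lambda_{n+j}$: for every $n\in\mathbb{Z}$ and any sequence $\{f_\ell\in\Lambda_\ell\}_{\ell\le n}$, the limit $$h_n=\lim_{k\to\infty}\frac{\mathbf{L}_{n-k}^kf_{n-k}}{\boldsymbol{\lambda}_{n-k}^k\langle f_{n-k},m_{n-k}\rangle}$$ exists in the uniform norm and is independent of the choice of the $f_\ell$. [F] For every $n\in\mathbb{Z}$, $h_n$ is strictly positive, lies in $\Lambda_n$, and satisfies $\int h_n\,dm_n=1$ and $L_nh_n=\lambda_nh_{n+1}$. [G] $(h_n)_{n\in\mathbb{Z}}$ is the unique sequence of functions $h_n\in\Lambda_n$ such that $\int h_n\,dm_n=1$ and $L_nh_n$ is a scalar multiple of $h_{n+1}$ for all $n\in\mathbb{Z}$. [H] There exist $C_2>0$ and $\gamma\in(0,1)$ such that for any $n\in\mathbb{Z}$, any $k\ge\tau$, and any $f\in\Lambda_{n-k}$, $$\Big\|h_n-\frac{\mathbf{L}_{n-k}^kf}{\boldsymbol{\lambda}_{n-k}^k\langle f,m_{n-k}\rangle}\Big\|\le C_2\gamma^k.$$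
   Context: A subset $\Lambda\subset\Omega\setminus\{0\}$ of a Banach space $\Omega$ is a convex cone if $t\Lambda=\Lambda$ for all $t>0$ and $f+g\in\Lambda$ for all $f,g\in\Lambda$; it is a closed convex cone if moreover $\Lambda\cup\{0\}$ is norm-closed. Write $f\preceq g$ iff $g-f\in\Lambda\cup\{0\}$, $A(f,g)=\sup\{t>0:tf\preceq g\}$, $B(f,g)=\inf\{t>0:g\preceq tf\}$. The Hilbert projective metric of $\Lambda$ is $\Theta(f,g)=\log\frac{B(f,g)}{A(f,g)}\in[0,\infty]$. $C(X_n)$ has the sup norm $\|\cdot\|=\|\cdot\|_\infty$; $C_n^+=\{f\in C(X_n):f\ge0,f\not\equiv0\}$; $\mathbf{1}$ is the constant function $1$; $\mathbf{L}_n^k=L_{n+k-1}\circ\cdots\circ L_n\colon C(X_n)\to C(X_{n+k})$ ($\mathbf{L}_n^0$ the identity). $M(X_n)$ is the set of positive (nonzero) finite Borel measures on $X_n$; $\langle f,m\rangle=\int f\,dm$; $L_n^*$ is the dual operator, defined by $\langle f,L_n^*m\rangle=\langle L_nf,m\rangle$ for $f\in C(X_n)$, $m\in M(X_{n+1})$, and similarly $(\mathbf{L}_n^k)^*$. $\Theta_n$ is the Hilbert projective metric of $\Lambda_n$. The conditions are (for all $n\in\mathbb{Z}$): (C1) Each $\Lambda_n\subset C(X_n)$ is a closed convex cone with $\mathbf{1}\in\Lambda_n\subset C_n^+$. (C2) Each $L_n$ is a bounded linear operator with $L_n\Lambda_n\subset\Lambda_{n+1}$, and there exists $\kappa\ge1$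 such that for all $n$, $\kappa^{-1}\le L_n\mathbf{1}(x)\le\kappa$ for all $x\in X_{n+1}$ and $\|L_nf\|_\infty\le\kappa\|f\|_\infty$ for all $f\in\Lambda_n$. Moreover there exist $\Delta\in(0,\infty)$ and $\tau\in\mathbb{N}$ such that for every $n$, $\operatorname{diam}_{\Theta_{n+\tau}}\mathbf{L}_n^\tau\Lambda_n\le\Delta$ and $\sup\mathbf{L}_n^\tau\mathbf{1}\le e^\Delta\inf\mathbf{L}_n^\tau\mathbf{1}$. (C3) With $\Lambda_n^p=\{f\in C_n^+:\mathbf{L}_n^pf\in\Lambda_{n+p}\}$ and $\Lambda_n^\infty=\bigcup_{p=0}^\infty\Lambda_n^p$, the set $\Lambda_n^\infty-\Lambda_n^\infty$ is uniformly dense in $C(X_n)$ for every $n$.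
   Formalization: Added hypothesis: each dual L_n^* maps M(X_{n+1}) into M(X_n), i.e. sends positive nonzero finite measures to such measures (so L_n is positive); (C1)–(C3) do not imply this, and without it m_n may be a signed functional, not a probability measure. *)

(* Defs.v *)
(* MathComp-Analysis, over an arbitrary real number structure [R : realType]. *)
From HB Require Import structures.
From mathcomp Require Import all_boot all_order all_algebra.
From mathcomp Require Import all_classical all_reals all_analysis.

Set Implicit Arguments.
Unset Strict Implicit.
Unset Printing Implicit Defensive.

Import Order.TTheory GRing.Theory Num.Theory.
Import numFieldNormedType.Exports.

Local Open Scope classical_set_scope.
Local Open Scope ring_scope.

(* The base point is not mathematical data: the library's measurable types are
   pointed, so a Borel sigma-algebra can only be put on a space with one. *)
HB.mixin Record isCompactSpace T & Topological T := {
  compact_space : compact [set: T]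
}.

#[short(type="compactMetricType")]
HB.structure Definition CompactMetric (R : numDomainType) :=
  {T of Metric R T & isPointed T & isCompactSpace T}.

Notation Cspace R X := (continuousType X R).

Section continuous_functions.
Context {R : realType}.
Variable X : compactMetricType R.
Notation C := (Cspace R X).
Implicit Types (f g h : C) (a b : R).

Lemma C_continuous f : continuous (f : X -> R).
Proof. exact: cts_fun. Qed.

Definition mkC (f : X -> R) (cf : continuous f) : C :=
  [the continuousType X R of mkcts cf].

Lemma C_ext f g : (forall x, f x = g x) -> f = g.
Proof. by move=> fg; apply/continuousEP. Qed.

Let zero_cont : continuous (fun _ : X => 0 : R).
Proof. by move=> x; exact: cvg_cst. Qed.
Let one_cont : continuous (fun _ : X => 1 : R).
Proof. by move=> x; exact: cvg_cst. Qed.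
Let opp_cont f : continuous (fun x => - f x).
Proof. by move=> x; apply: (@cvgN _ R^o); exact: C_continuous. Qed.
Let add_cont f g : continuous (fun x => f x + g x).
Proof. by move=> x; apply: (@cvgD _ R^o); exact: C_continuous. Qed.
Let scale_cont a f : continuous (fun x => a * f x).
Proof. by move=> x; apply: cvgM; [exact: cvg_cst|exact: C_continuous]. Qed.

Definition Czero : C := mkC zero_cont.
Definition Cst1 : C := mkC one_cont.
Definition Copp f : C := mkC (@opp_cont f).
Definition Cadd f g : C := mkC (@add_cont f g).
Definition Cscale a f : C := mkC (@scale_cont a f).

Let CaddA : associative Cadd.
Proof. by move=> f g h; apply: C_ext => x; exact: addrA. Qed.
Let CaddC : commutative Cadd.
Proof. by move=> f g; apply: C_ext => x; exact: addrC. Qed.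
Let Cadd0 : left_id Czero Cadd.
Proof. by move=> f; apply: C_ext => x; exact: add0r. Qed.
Let CaddN : left_inverse Czero Copp Cadd.
Proof. by move=> f; apply: C_ext => x; exact: addNr. Qed.

HB.instance Definition _ := GRing.isZmodule.Build C CaddA CaddC Cadd0 CaddN.

Let CscaleA a b f : Cscale a (Cscale b f) = Cscale (a * b) f.
Proof. by apply: C_ext => x; exact: mulrA. Qed.
Let Cscale1 : left_id 1 Cscale.
Proof. by move=> f; apply: C_ext => x; exact: mul1r. Qed.
Let CscaleDr : right_distributive Cscale +%R.
Proof. by move=> a f g; apply: C_ext => x; exact: mulrDr. Qed.
Let CscaleDl f : {morph Cscale^~ f : a b / a + b}.
Proof. by move=> a b; apply: C_ext => x; exact: mulrDl. Qed.

HB.instance Definition _ :=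
  GRing.Zmodule_isLmodule.Build R C CscaleA Cscale1 CscaleDr CscaleDl.

Lemma C0E x : (0 : C) x = 0. Proof. by []. Qed.
Lemma C1E x : Cst1 x = 1. Proof. by []. Qed.
Lemma CDE f g x : (f + g) x = f x + g x. Proof. by []. Qed.
Lemma CNE f x : (- f) x = - f x. Proof. by []. Qed.
Lemma CZE a f x : (a *: f) x = a * f x. Proof. by []. Qed.

Definition sup_norm f : R := sup (range (fun x => `|f x|)).

Let norm_has_sup f : has_sup (range (fun x => `|f x|)).
Proof.
split; first by exists `|f point|; exists point.
have cf : {within [set: X], continuous (fun x => `|f x|)}.
  apply: continuous_subspaceT => x.
  by apply: (@cvg_norm _ R^o); exact: C_continuous.
have [c _ fc] := compact_EVT_max (ex_intro _ point I) compact_space cf.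
by exists `|f c| => _ [x _ <-]; apply: fc; rewrite inE.
Qed.

Lemma le_sup_norm f x : `|f x| <= sup_norm f.
Proof. by apply: (ub_le_sup (norm_has_sup f).2); exists x. Qed.

Lemma sup_norm_le f a : (forall x, `|f x| <= a) -> sup_norm f <= a.
Proof.
by move=> fa; apply: (ge_sup (norm_has_sup f).1) => _ [x _ <-].
Qed.

Let sup_normD f g : sup_norm (f + g) <= sup_norm f + sup_norm g.
Proof.
apply: sup_norm_le => x; rewrite CDE (le_trans (ler_normD _ _))//.
by rewrite lerD// le_sup_norm.
Qed.

Let sup_normZ a f : sup_norm (a *: f) = `|a| * sup_norm f.
Proof.
have le b g : sup_norm (b *: g) <= `|b| * sup_norm g.
  by apply: sup_norm_le => x; rewrite CZE normrM ler_wpM2l// le_sup_norm.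
apply/eqP; rewrite eq_le le /=; have [->|a0] := eqVneq a 0.
  by rewrite normr0 mul0r (le_trans _ (le_sup_norm _ point)).
rewrite -ler_pdivlMl ?normr_gt0// -normfV.
by have := le a^-1 (a *: f); rewrite scalerA mulVf// scale1r.
Qed.

Let sup_norm_eq0 f : sup_norm f = 0 -> f = 0.
Proof.
move=> f0; apply: C_ext => x; apply/eqP.
by rewrite -normr_le0 -f0 le_sup_norm.
Qed.

HB.instance Definition _ :=
  Lmodule_isNormed.Build R C sup_normD sup_normZ sup_norm_eq0.

Lemma C_normE f : `|f| = sup (range (fun x => `|f x|)). Proof. by []. Qed.

Definition Cplus : set C := [set f | (forall x, 0 <= f x) /\ f <> 0].

End continuous_functions.
Arguments Cst1 {R} X.
Arguments Cplus {R} X.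

Definition bounded_operator {R : realType} (V W : normedModType R)
    (T : V -> W) : Prop := exists c : R, forall f, `|T f| <= c * `|f|.

Section cones.
Context {R : realType} {Omega : normedModType R}.
Implicit Types (K S : set Omega) (f g : Omega).

Definition convex_cone K : Prop :=
  [/\ ~ K 0,
      forall t : R, 0 < t -> [set t *: f | f in K] = K
    & forall f g, K f -> K g -> K (f + g)].

Definition closed_convex_cone K : Prop :=
  convex_cone K /\ closed (K `|` [set 0]).

Definition cone_le K f g : Prop := (K `|` [set 0]) (g - f).

Local Open Scope ereal_scope.

(* The suprema and infima are taken in [0, +oo]: the supremum of no [t] is 0,
   whence the explicit 0 below, and the infimum of no [t] is +oo. *)
Definition cone_A K f g : \bar R :=
  ereal_sup (0 |` [set t%:E | t in [set t : R | (0 < t)%R /\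
                                    cone_le K (t *: f)%R g]]).

Definition cone_B K f g : \bar R :=
  ereal_inf [set t%:E | t in [set t : R | (0 < t)%R /\
                                    cone_le K g (t *: f)%R]].

(* In [\bar R], the inverse of 0 is +oo, so that B / 0 = +oo for B > 0. *)
Definition hilbert_metric K f g : \bar R := lne (cone_B K f g / cone_A K f g).

Definition hilbert_diam K S : \bar R :=
  ereal_sup [set hilbert_metric K p.1 p.2 | p in S `*` S].

End cones.

Section borel_measures.
Context {R : realType}.
Implicit Types X Y : compactMetricType R.

Definition borel X := g_sigma_algebraType (@open X).

Definition finmeas X := {finite_measure set (borel X) -> \bar R}.

HB.instance Definition _ X := gen_eqMixin (finmeas X).
HB.instance Definition _ X := gen_choiceMixin (finmeas X).

Definition Mspace X : set (finmeas X) :=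
  [set mu | mu [set: borel X] <> 0%E].

Definition pairing X (f : Cspace R X) (mu : finmeas X) : R :=
  (\int[mu]_(x in [set: borel X]) f x)%R.

(* Measures of the library are functions on all sets, with no constraint on
   the values at non-measurable sets. *)
Definition measure_eq X (mu nu : finmeas X) : Prop :=
  forall A : set (borel X), measurable A -> mu A = nu A.

Definition measure_eqZ X (mu : finmeas X) (c : R) (nu : finmeas X) : Prop :=
  forall A : set (borel X), measurable A -> mu A = (c%:E * nu A)%E.

Definition is_dual X Y (T : Cspace R X -> Cspace R Y) (sigma : finmeas Y)
    (mu : finmeas X) : Prop :=
  forall f : Cspace R X, pairing f mu = pairing (T f) sigma.

Definition dual X Y (T : Cspace R X -> Cspace R Y) (sigma : finmeas Y) : finmeas X
  := xget (mzero : finmeas X) [set mu | is_dual T sigma mu].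

(* That T^* is a map from M(Y) to M(X) is a condition on T: a bounded operator
   that is not positive sends some measures to signed ones. Under this condition
   [is_dual] determines [dual T] on Borel sets. *)
Definition dual_acts_on_measures X Y (T : Cspace R X -> Cspace R Y) : Prop :=
  forall sigma, Mspace sigma -> exists2 mu, Mspace mu & is_dual T sigma mu.

Let pairing1_ge0 X (mu : finmeas X) : 0 <= pairing (Cst1 X) mu.
Proof. exact: Rintegral_ge0. Qed.

Definition normalize X (mu : finmeas X) : finmeas X :=
  mscale ((NngNum (pairing1_ge0 mu))%:num^-1)%:nng mu.

Definition weakstar_cvg X (mu_ : nat -> finmeas X) (mu : finmeas X) : Prop :=
  forall f : Cspace R X, pairing f (mu_ k) @[k --> \oo] --> pairing f mu.

End borel_measures.

Section nonstationary.
Context {R : realType} {X : int -> compactMetricType R}.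
Implicit Types (n : int) (k j p tau : nat).
Unset Implicit Arguments.
Local Notation C n := (Cspace R (X n)).
Variable L : forall n, {linear C n -> C (n + 1)}.

Definition castC m n (e : m = n) (f : C m) : C n := ecast i (C i) e f.
Arguments castC {m n} e f.

Lemma iterS_subproof n k : n + k%:Z + 1 = n + k.+1%:Z.
Proof. by rewrite -addrA -[k.+1]addn1 PoszD. Qed.

(* L_n^k, that is, L_(n+k-1) o ... o L_n *)
Fixpoint iterL n k : C n -> C (n + k%:Z) :=
  match k with
  | 0%N => castC (esym (addr0 n))
  | j.+1 => fun f => castC (iterS_subproof n j) (L (n + j%:Z) (iterL n j f))
  end.

Lemma iter_next_subproof n j : n + 1 + j%:Z = n + j.+1%:Z.
Proof. by rewrite -addrA -[j.+1]add1n PoszD. Qed.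

(* L_(n+1)^(k-1), for k = j.+1, as a map into C (X (n + k)) *)
Definition iterL_next n j (f : C (n + 1)) : C (n + j.+1%:Z) :=
  castC (iter_next_subproof n j) (iterL (n + 1) j f).

(* L_(n-k)^k, as a map into C (X n) *)
Definition iterL_to n k (f : C (n - k%:Z)) : C n :=
  castC (subrK k%:Z n) (iterL (n - k%:Z) k f).

Definition lambda_ratio n j (sigma : finmeas (X (n + j.+1%:Z))) : R :=
  pairing (iterL n j.+1 (Cst1 (X n))) sigma /
  pairing (iterL_next n j (Cst1 (X (n + 1)))) sigma.

Variable Lam : forall n, set (C n).

Definition condC1 : Prop := forall n,
  [/\ closed_convex_cone (Lam n), Lam n (Cst1 (X n)) & Lam n `<=` Cplus (X n)].

Definition condC2 (kappa Delta : R) tau : Prop :=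
  [/\ forall n, bounded_operator (L n) /\ L n @` Lam n `<=` Lam (n + 1),
      1 <= kappa /\
      (forall n,
         (forall x, kappa^-1 <= L n (Cst1 (X n)) x <= kappa) /\
         (forall f, Lam n f -> `|L n f| <= kappa * `|f|)),
      0 < Delta
    & forall n,
        (hilbert_diam (Lam (n + tau%:Z)) (iterL n tau @` Lam n) <= Delta%:E)%E
        /\ sup (range (iterL n tau (Cst1 (X n)))) <=
           expR Delta * inf (range (iterL n tau (Cst1 (X n))))].

Definition Lam_p n p : set (C n) :=
  [set f | Cplus (X n) f /\ Lam (n + p%:Z) (iterL n p f)].

Definition Lam_infty n : set (C n) := \bigcup_p Lam_p n p.

Definition condC3 : Prop := forall n,
  dense [set f - g | f in Lam_infty n & g in Lam_infty n].

Definition eigenmeasures (m : forall n, finmeas (X n)) : Prop := forall n,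
  m n [set: borel (X n)] = 1%E /\
  exists c : R, measure_eqZ (dual (L n) (m (n + 1))) c (m n).

Definition eigenfunctions (m : forall n, finmeas (X n)) (h : forall n, C n) :
    Prop := forall n,
  [/\ Lam n (h n),
      pairing (h n) (m n) = 1
    & exists c : R, L n (h n) = c *: h (n + 1)].

End nonstationary.

Definition lambda_prod {R : realType} (lam : int -> R) (n : int) (k : nat) : R :=
  \prod_(0 <= j < k) lam (n + j%:Z).

(* Main.v *)
Require Import Defs.
From HB Require Import structures.
From mathcomp Require Import all_boot all_order all_algebra.
From mathcomp Require Import all_classical all_reals all_analysis.
From mathcomp Require Import measurable_realfun zify ring lra.
Set Implicit Arguments.
Unset Strict Implicit.
Unset Printing Implicit Defensive.
Import Order.TTheory GRing.Theory Num.Theory.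
Import numFieldNormedType.Exports.
Local Open Scope classical_set_scope.
Local Open Scope ring_scope.

(** Why the theorem holds.  An operator whose dual preserves positive measures is
    positive, so its iterates respect both the pointwise order and the finer
    orders of the cones.  Suppose that [a g <= f <= b g] in the order of the cone
    at some time.  Then [f - a g] and [b g - f] lie in the cone; [tau] steps later
    the diameter bound makes both of them comparable to the image of [g], with
    constants whose ratio is at most [M = exp (Delta + 1)].  As they add up to
    [(b - a) g], the two ends of the order interval move towards each other by at
    least [(b - a) / M].  So the length of the interval decays exponentially
    ([contraction_step], [contraction_rate_exists]).

    With [g = 1] this says that the pointwise quotient of the iterates of [f] and
    of [1] tends to a constant [Phi f], uniformly over the space.  The limit exists
    first for [f] in the cone, then on [Lam_infty] as a quotient of two such
    limits, and then for all continuous [f] by density ([close_exists]).  Since the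
    convergence is uniform in the point, averaging numerator and denominator
    against any measure at the final time gives the same limit at the same speed,
    which is why the choice of the measures [sigma] is irrelevant.  The functional
    [Phi] is linear, positive and normalized, hence is integration against a
    probability measure [m_n] ([riesz_representation]), and
    [Phi (L f) = Phi (L 1) * Phi f] is the relation [L_n^* m_(n+1) = lambda_n m_n]
    with [lambda_n = Phi (L_n 1)].  Any other sequence of probability measures with
    this property up to scalars is the normalized pull-back of its own late terms,
    hence equals [m_n].

    For the functions [h_n], iterate two elements of a cone for [k] steps and scale
    both images so that [Phi] is 1 on them.  If [a v <= u <= b v] for these images
    then [a <= 1 <= b], so that [u - v] is at most [b / a - 1] times [v], and [v] is
    bounded because the images have bounded oscillation ([normal_ev_dist],
    [ev_oscillation]).  Consequently the scaled images of elements taken further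
    and further in the past form a Cauchy sequence, whose limit [h_n] does not
    depend on them.  Closedness of the cone puts [h_n] in it, and an equivariant
    normalized family is the scaled image of its own past, hence equals [h_n]. *)

(** * Integration of continuous functions *)

Section pairing_theory.
Context {R : realType} {X : compactMetricType R}.
Local Notation C := (Cspace R X).
Implicit Types (f g : C) (mu nu : finmeas X).

Lemma C_measurable f : measurable_fun [set: borel X] (f : borel X -> R).
Proof.
apply: (measurability _ (RGenOpens.measurableE R)) => //.
move=> _ [_ [a [b ->] <-]]; rewrite setTI; apply: sub_sigma_algebra.
have /continuousP := @C_continuous _ _ f; apply; exact: interval_open.
Qed.

Lemma C_integrable mu f :
  mu.-integrable [set: borel X] (EFin \o (f : borel X -> R)).
Proof.
apply: measurable_bounded_integrable => //.
- by rewrite ltey_eq fin_num_measure.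
- exact: C_measurable.
- exists `|f|; split; first exact: num_real.
  by move=> M fM x _ /=; rewrite (le_trans (le_sup_norm f x))// ltW.
Qed.

Lemma pairingD mu f g : pairing (f + g) mu = pairing f mu + pairing g mu.
Proof. by rewrite /pairing RintegralD//; exact: C_integrable. Qed.

Lemma pairingZ mu a f : pairing (a *: f) mu = a * pairing f mu.
Proof. by rewrite /pairing -RintegralZl//; exact: C_integrable. Qed.

Lemma le_pairing mu f g : (forall x, f x <= g x) -> pairing f mu <= pairing g mu.
Proof. by move=> fg; apply: le_Rintegral => //; exact: C_integrable. Qed.

Lemma pairing1 mu : pairing (Cst1 X) mu = fine (mu [set: borel X]).
Proof. by rewrite /pairing Rintegral_cst// mul1r. Qed.

Lemma pairing1_gt0 mu : Mspace mu -> 0 < pairing (Cst1 X) mu.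
Proof.
move=> mu0; rewrite pairing1 fine_gt0// lt0e measure_ge0 andbT.
by rewrite ltey_eq fin_num_measure// andbT; apply/eqP.
Qed.

Lemma Mspace_pairing1 mu : 0 < pairing (Cst1 X) mu -> Mspace mu.
Proof. by rewrite pairing1 => + mu0; rewrite mu0 ltxx. Qed.

Lemma eq_pairing mu nu f : measure_eq mu nu -> pairing f mu = pairing f nu.
Proof.
move=> munu; rewrite /pairing /Rintegral; congr fine.
by apply: eq_measure_integral => A mA _; exact: munu.
Qed.

Lemma pairing_mscale mu (k : {nonneg R}) f :
  (\int[mscale k mu]_(x in [set: borel X]) f x)%R = k%:num * pairing f mu.
Proof.
have mf : measurable_fun [set: borel X] (fun x : borel X => (f x)%:E).
  by apply/measurable_EFinP; exact: C_measurable.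
rewrite /pairing /Rintegral integralE [in RHS]integralE.
rewrite !ge0_integral_mscale//; try exact: measurable_funepos;
  try exact: measurable_funeneg.
have ifi := C_integrable mu f.
rewrite -muleBr ?fineM//; last first.
- apply: fin_num_adde_defl; rewrite fin_numN.
  exact: integrable_neg_fin_num ifi.
- rewrite fin_numB; apply/andP; split; first exact: integrable_pos_fin_num ifi.
  exact: integrable_neg_fin_num ifi.
Qed.

Lemma pairing_normalize mu f :
  pairing f (normalize mu) = pairing f mu / pairing (Cst1 X) mu.
Proof. by rewrite /pairing pairing_mscale mulrC. Qed.

Lemma exists_dirac (x : X) : exists2 mu, Mspace mu & forall f, pairing f mu = f x.
Proof.
exists ((\d_(x : borel X)) : {finite_measure set (borel X) -> \bar R}).
  by rewrite /Mspace/= diracT; apply/eqP; rewrite onee_neq0.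
move=> f; rewrite /pairing /Rintegral integral_dirac// ?diracT ?mul1e//.
by apply/measurable_EFinP; exact: C_measurable.
Qed.
End pairing_theory.

(** * Continuous functions on a compact metric space *)

Section lattice.
Context {R : realType} {X : compactMetricType R}.
Local Notation C := (Cspace R X).
Implicit Types (f g : C) (U : set X).

Let min_cont f g : continuous (fun x => Num.min (f x) (g x)).
Proof. by move=> x; apply: continuous_min; exact: C_continuous. Qed.

Let max_cont f g : continuous (fun x => Num.max (f x) (g x)).
Proof. by move=> x; apply: continuous_max; exact: C_continuous. Qed.

Definition Cmin f g : C := mkC (@min_cont f g).
Definition Cmax f g : C := mkC (@max_cont f g).

Lemma CminE f g x : Cmin f g x = Num.min (f x) (g x). Proof. by []. Qed.
Lemma CmaxE f g x : Cmax f g x = Num.max (f x) (g x). Proof. by []. Qed.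

Lemma open_lt f (a : R) : open [set x | f x < a].
Proof.
have /continuousP/(_ [set y | y < a]) := @C_continuous _ _ f.
by apply; exact: open_lt.
Qed.

Lemma open_gt f (a : R) : open [set x | a < f x].
Proof.
have /continuousP/(_ [set y | a < y]) := @C_continuous _ _ f.
by apply; exact: open_gt.
Qed.

(** The distance to the complement of [U], except when the complement is empty:
    that distance is then infinite, and the constant 1 replaces it. *)
Lemma open_positivity_set U : open U ->
  exists d : C, (forall x, 0 <= d x) /\ (forall x, 0 < d x <-> U x).
Proof.
move=> oU; have [U0|/set0P[a nUa]] := eqVneq (~` U) set0.
  exists (Cst1 X); split => x; rewrite C1E//; split => // _.
  by apply: contrapT => nUx; have : (~` U) x by []; rewrite U0.
have fin x : edist_inf (R := R) (~` U) x \is a fin_num.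
  rewrite ge0_fin_numE ?edist_inf_ge0//.
  apply: (@le_lt_trans _ _ (edist (x, a))).
    by apply: ereal_inf_lbound; exists a.
  rewrite -ge0_fin_numE ?edist_ge0//; apply/edist_finP.
  exists (mdist x a + 1); first by rewrite ltr_wpDl// mdist_ge0.
  by rewrite /= ballEmdist/= ltrDl.
have cd : continuous (fun x : X => fine (edist_inf (R := R) (~` U) x)).
  move=> x; apply: fine_cvg; rewrite fineK//; exact: edist_inf_continuous.
have dE x : mkC cd x = fine (edist_inf (R := R) (~` U) x) by [].
exists (mkC cd); split => x; rewrite dE; first exact/fine_ge0/edist_inf_ge0.
split; first by apply: contraPP => nUx; rewrite edist_inf0//= ltxx.
move=> Ux; have /nbhs_ballP[e/= e0 eU] := open_nbhs_nbhs (conj oU Ux).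
apply: (@lt_le_trans _ _ e) => //; rewrite -lee_fin fineK//.
apply: le_ereal_inf_tmp => _ [y nUy <-]; rewrite leNgt; apply/negP.
by move=> /edist_lt_ball/= /eU.
Qed.

End lattice.

(** The limit at [x] is taken to be the supremum of the eventual lower bounds of
    [v k x]: both halves of the estimate can then be read off the definition. *)
Lemma uniform_cauchy_lim (R : realType) (Y : compactMetricType R)
    (v : nat -> Cspace R Y) (r : nat -> R) (k0 : nat) :
  (forall j k, (k0 <= k <= j)%N -> forall x, `|v j x - v k x| <= r k) ->
  (forall e, 0 < e -> exists2 k, (k0 <= k)%N & r k <= e) ->
  exists h : Cspace R Y, forall k, (k0 <= k)%N -> forall x, `|h x - v k x| <= r k.
Proof.
move=> vr r0.
pose S x := [set a | exists K, forall k, (K <= k)%N -> a <= v k x].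
have Slo k x : (k0 <= k)%N -> S x (v k x - r k).
  move=> k0k; exists k => j kj; have := vr j k; rewrite k0k kj => /(_ isT x).
  by rewrite ler_norml => /andP[+ _]; lra.
have Sub k x : (k0 <= k)%N -> ubound (S x) (v k x + r k).
  move=> k0k a [K hK]; apply: le_trans (hK (maxn K k) (leq_maxl _ _)) _.
  have := vr (maxn K k) k; rewrite k0k leq_maxr => /(_ isT x).
  by rewrite ler_norml => /andP[_]; lra.
have Ssup x : has_sup (S x).
  split; first by exists (v k0 x - r k0); exact: Slo.
  by exists (v k0 x + r k0); exact: Sub.
pose h x := sup (S x).
have hv k x : (k0 <= k)%N -> `|h x - v k x| <= r k.
  move=> k0k; have h1 : v k x - r k <= h x.
    by apply: (ub_le_sup (Ssup x).2); exact: Slo.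
  have h2 : h x <= v k x + r k by apply: (ge_sup (Ssup x).1); exact: Sub.
  by rewrite ler_norml; apply/andP; split; lra.
suff hc : continuous h by exists (mkC hc) => k k0k x; exact: hv.
move=> x; apply/cvgrPdist_le => e e0.
have [k k0k rk] := r0 (e / 3) (divr_gt0 e0 (ltr0Sn _ 2)).
have := @C_continuous _ _ (v k) x.
move=> /cvgrPdist_le/(_ (e / 3) (divr_gt0 e0 (ltr0Sn _ 2))).
apply: filterS => y vxy; have := hv k x k0k; have := hv k y k0k.
move: vxy; rewrite !ler_norml => /andP[? ?] /andP[? ?] /andP[? ?].
by apply/andP; split; lra.
Qed.

(** * The Riesz representation theorem on a compact metric space *)

Section riesz.
Context {R : realType} {X : compactMetricType R}.
Local Notation C := (Cspace R X).
Implicit Types (f g d : C) (U V A : set X).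
Variable Phi : C -> R.
Hypothesis PhiD : forall f g : C, Phi (f + g) = Phi f + Phi g.
Hypothesis PhiZ : forall a (f : C), Phi (a *: f) = a * Phi f.
Hypothesis Phi_ge0 : forall f : C, (forall x, 0 <= f x) -> 0 <= Phi f.

Lemma le_Phi f g : (forall x, f x <= g x) -> Phi f <= Phi g.
Proof.
move=> fg; rewrite -subr_ge0 -mulN1r -PhiZ -PhiD scaleN1r; apply: Phi_ge0 => x.
by rewrite CDE CNE subr_ge0.
Qed.

Let Phi1_ge0 : 0 <= Phi (Cst1 X).
Proof. by apply: Phi_ge0 => x; rewrite C1E. Qed.

Definition subordinate U f : Prop :=
  (forall x, 0 <= f x <= 1) /\ (forall x, ~ U x -> f x = 0).

(** The mass that an open set has to receive.  Functions are only required to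
    vanish off [U]; [positive_part_subordinate] passes from them to functions
    supported inside [U]. *)
Definition rho U : R := sup [set Phi f | f in subordinate U].

Lemma subordinate0 U : subordinate U 0.
Proof. by split=> x; rewrite C0E // lexx ler01. Qed.

Let rho_has_sup U : has_sup [set Phi f | f in subordinate U].
Proof.
split; first by exists (Phi 0); exists 0 => //; exact: subordinate0.
exists (Phi (Cst1 X)) => _ [f [f01 _] <-]; apply: le_Phi => x.
by rewrite C1E; case/andP: (f01 x).
Qed.

Lemma le_rho U f : subordinate U f -> Phi f <= rho U.
Proof. by move=> Uf; apply: (ub_le_sup (rho_has_sup U).2); exists f. Qed.

Lemma rho_le U M : (forall f, subordinate U f -> Phi f <= M) -> rho U <= M.
Proof.
move=> UM; apply: (ge_sup (rho_has_sup U).1) => _ [f Uf <-]; exact: UM.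
Qed.

Lemma rho_adherent U e : 0 < e -> exists2 f, subordinate U f & rho U - e < Phi f.
Proof. by move=> /sup_adherent/(_ (rho_has_sup U))[_ [f Uf <-]]; exists f. Qed.

Lemma rho_ge0 U : 0 <= rho U.
Proof.
apply: (le_trans _ (le_rho (subordinate0 U))).
by apply: Phi_ge0 => x; rewrite C0E.
Qed.

Lemma rhoS U V : U `<=` V -> rho U <= rho V.
Proof.
move=> UV; apply: rho_le => f [f01 fU]; apply: le_rho; split=> // x nVx.
by apply: fU => /UV.
Qed.

Lemma rho_setT : rho setT = Phi (Cst1 X).
Proof.
apply/eqP; rewrite eq_le le_rho ?andbT.
  by apply: rho_le => f [f01 _]; apply: le_Phi => x; case/andP: (f01 x).
by split=> x; [rewrite C1E ler01 lexx | case].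
Qed.

Lemma rho_set0 : rho set0 = 0.
Proof.
apply/eqP; rewrite eq_le rho_ge0 andbT; apply: rho_le => f [_ f0].
rewrite -(mul0r (Phi f)) -PhiZ; apply: le_Phi => x.
by rewrite f0// CZE mul0r.
Qed.

(** Cutting off the height [e] costs at most [e * Phi 1], and leaves a function
    that vanishes on the neighbourhood [{f < e}] of the complement of [U]. *)
Lemma positive_part_subordinate U f e : 0 < e -> subordinate U f ->
  exists f', [/\ subordinate U f', forall x, f x <= e -> f' x = 0,
    forall x, f' x <= Num.max 0 (f x - e) & Phi f <= Phi f' + e * Phi (Cst1 X)].
Proof.
move=> e0 [f01 fU]; exists (Cmax 0 (f + (- e) *: Cst1 X)).
have E x : Cmax 0 (f + (- e) *: Cst1 X) x = Num.max 0 (f x - e).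
  by rewrite CmaxE C0E CDE CZE C1E mulr1.
split.
- split=> x; rewrite E; have /andP[] := f01 x.
    by move=> f0 f1; rewrite le_max lexx/= ge_max; apply/andP; split; lra.
  by move=> _ _ /fU ->; apply/max_idPl; lra.
- by move=> x fe; rewrite E; apply/max_idPl; lra.
- by move=> x; rewrite E.
- rewrite -PhiZ -PhiD; apply: le_Phi => x.
  rewrite CDE E CZE C1E mulr1 -lerBlDr le_max lexx orbT//.
Qed.

(** Subadditivity by Riesz decomposition: [f] is the sum of [min f (c N)], which
    vanishes off [U N], and of a remainder dominated by the other [c i]. *)
Lemma le_Phi_sum (N : nat) (U : nat -> set X) (c : nat -> C) f :
  (forall i x, 0 <= c i x) -> (forall i x, ~ U i x -> c i x = 0) ->
  (forall x, 0 <= f x <= 1) -> (forall x, f x <= \sum_(i < N) c i x) ->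
  Phi f <= \sum_(i < N) rho (U i).
Proof.
move=> c0 cU; elim: N f => [|N IH] f f01 fc.
  rewrite big_ord0 -(mul0r (Phi f)) -PhiZ; apply: le_Phi => x.
  by rewrite CZE mul0r; have := fc x; rewrite big_ord0.
rewrite big_ord_recr/=; pose g := Cmin f (c N).
have -> : f = (f + (-1) *: g) + g by rewrite scaleN1r subrK.
have gE x : g x = Num.min (f x) (c N x) by [].
have fgE x : (f + (-1) *: g) x = f x - g x by rewrite CDE CZE mulN1r.
have gx x : g x = f x \/ g x = c N x /\ c N x <= f x.
  have [h|/ltW h] := leP (f x) (c N x); [left|right].
    by rewrite gE; apply/min_idPl.
  by split=> //; rewrite gE; apply/min_idPr.
rewrite PhiD lerD//.
- apply: IH => x; rewrite fgE; have /andP[f0 f1] := f01 x; have := c0 N x.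
    by case: (gx x) => [->|[-> ?]] ?; apply/andP; split; lra.
  have := fc x; rewrite big_ord_recr/=.
  case: (gx x) => [->|[-> ?]] ?; last by lra.
  by rewrite subrr sumr_ge0.
- apply: le_rho; split=> x.
    by have /andP[f0 f1] := f01 x; have := c0 N x;
      case: (gx x) => [->|[-> ?]] ?; apply/andP; split; lra.
  by move=> /cU cN; rewrite gE cN; apply/min_idPr; case/andP: (f01 x).
Qed.

(** As in Dini's theorem: the right-hand sides increase with [N] and each point
    has a neighbourhood on which some [N] works, so that by compactness a single
    [N] works everywhere. *)
Lemma dini_cover (U : nat -> set X) (d : nat -> C) f e : 0 < e ->
  (forall n x, 0 <= d n x) -> (forall n x, U n x -> 0 < d n x) ->
  (forall x, ~ (\bigcup_n U n) x -> f x = 0) ->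
  exists N, forall x, f x < e + N%:R * \sum_(i < N) d i x.
Proof.
move=> e0 d0 dU fU.
pose P (N : nat) x := f x < e + N%:R * \sum_(i < N) d i x.
have mono M N x : (M <= N)%N -> \sum_(i < M) d i x <= \sum_(i < N) d i x.
  move=> MN; rewrite (big_ord_widen N (fun i => d i x))//.
  by rewrite [leRHS](bigID (fun i : 'I_N => (i < M)%N))/= lerDl sumr_ge0.
have nc := (compact_near_coveringP [set: X]).1 compact_space.
suff [N _ NP] : \forall N \near \oo, [set: X] `<=` P N.
  by exists N => x; exact: (NP N (leqnn N)).
apply: nc => x _.
have [M PM] : exists M, P M x.
  have [[n _ Unx]|/fU fx0] := pselect ((\bigcup_n U n) x); last first.
    by exists 0%N; rewrite /P fx0 mul0r addr0.
  have dn0 := dU n x Unx.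
  (* N must exceed n, for the sum to see d n, and |f x| / d n x *)
  pose N := maxn n.+1 (Num.truncn (`|f x| / d n x)).+1.
  exists N; rewrite /P.
  apply: (@le_lt_trans _ _ `|f x|); first exact: ler_norm.
  apply: (@lt_le_trans _ _ (N%:R * d n x)).
    rewrite -ltr_pdivrMr//; apply: lt_le_trans (truncnS_gt _) _.
    by rewrite ler_nat leq_maxr.
  apply: (@le_trans _ _ (N%:R * \sum_(i < N) d i x)); last by rewrite lerDr ltW.
  apply: ler_wpM2l => //; apply: le_trans (mono n.+1 N x _); last exact: leq_maxl.
  by rewrite big_ord_recr/= lerDr sumr_ge0.
have {}PM : \forall y \near x, P M y.
  pose g := f + (- M%:R) *: \sum_(i < M) d i.
  have gE y : g y = f y - M%:R * \sum_(i < M) d i y.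
    rewrite CDE CZE mulNr; congr (_ - _ * _).
    exact: (big_morph (fun h : C => h y) (fun _ _ => erefl) erefl).
  have Px : (fun y => g y < e) x by rewrite gE ltrBlDr.
  have := open_nbhs_nbhs (conj (open_lt g e) Px).
  by apply: filterS => y /=; rewrite gE /P ltrBlDr.
near=> y n => /=.
have Py : P M y by near: y.
have Mn : (M <= n)%N by near: n; exists M.
rewrite /P; apply: lt_le_trans Py _; rewrite lerD2l.
by apply: ler_pM; rewrite ?sumr_ge0// ?ler_nat// mono.
Unshelve. all: by end_near. Qed.

(** After truncation, a function subordinate to the union is dominated by a
    multiple of finitely many functions positive exactly on the [U i]. *)
Lemma rho_bigcup_le (U : nat -> set X) M : (forall n, open (U n)) ->
  (forall N, \sum_(i < N) rho (U i) <= M) -> rho (\bigcup_n U n) <= M.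
Proof.
move=> oU UM; apply: rho_le => f Uf; apply/ler_addgt0Pr => e e0.
(* the truncation at e' costs e' * Phi 1; the + 1 also covers Phi 1 = 0 *)
pose e' := e / (Phi (Cst1 X) + 1).
have P1 : 0 < Phi (Cst1 X) + 1 by rewrite ltr_wpDl.
have e'0 : 0 < e' by rewrite divr_gt0.
have /choice[d dP] : forall n, exists d : C,
    (forall x, 0 <= d x) /\ (forall x, 0 < d x <-> U n x).
  by move=> n; exact: open_positivity_set.
have [f' [[f'01 f'U] f'0 f'2 Pf']] := positive_part_subordinate e'0 Uf.
have [N NP] := @dini_cover U d f e' e'0 (fun n => (dP n).1)
  (fun n x => ((dP n).2 x).2) Uf.2.
have le1 : Phi f' <= M.
  apply: le_trans (UM N); apply: (@le_Phi_sum N U (fun i => N%:R *: d i)) => //.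
  - by move=> i x; rewrite CZE mulr_ge0//; exact: (dP i).1.
  - move=> i x nUx; rewrite CZE; have [/(_ x) d0 /(_ x) dU] := dP i.
    have [->|dx] := eqVneq (d i x) 0; first by rewrite mulr0.
    by case: nUx; apply/dU; rewrite lt_def dx.
  - move=> x; apply: le_trans (f'2 x) _; rewrite ge_max; apply/andP; split.
      by apply: sumr_ge0 => i _; rewrite CZE mulr_ge0//; exact: (dP i).1.
    have := NP x; rewrite mulr_sumr => /ltW; rewrite lerBlDl => h.
    exact: le_trans h _.
apply: le_trans Pf' _; apply: lerD => //.
rewrite /e' mulrAC -mulrA ler_piMr ?ltW// ltr_pdivrMr// mul1r ltrDl ltr01//.
Qed.

Definition riesz_inf A : R := inf [set rho U | U in [set U | open U /\ A `<=` U]].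

Let riesz_has_inf A : has_inf [set rho U | U in [set U | open U /\ A `<=` U]].
Proof.
split; first by exists (rho setT); exists setT => //; split=> //; exact: openT.
by exists 0 => _ [U _ <-]; exact: rho_ge0.
Qed.

Lemma riesz_inf_le A U : open U -> A `<=` U -> riesz_inf A <= rho U.
Proof. by move=> oU AU; apply: (ge_inf (riesz_has_inf A).2); exists U. Qed.

Lemma le_riesz_inf A M : (forall U, open U -> A `<=` U -> M <= rho U) ->
  M <= riesz_inf A.
Proof.
move=> AM; apply: (lb_le_inf (riesz_has_inf A).1) => _ [U [oU AU] <-].
exact: AM.
Qed.

Lemma riesz_inf_open U : open U -> riesz_inf U = rho U.
Proof.
move=> oU; apply/eqP; rewrite eq_le riesz_inf_le//=.
by apply: le_riesz_inf => V _ UV; exact: rhoS.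
Qed.

Lemma riesz_inf_ge0 A : 0 <= riesz_inf A.
Proof. by apply: le_riesz_inf => U _ _; exact: rho_ge0. Qed.

Lemma riesz_infS A B : A `<=` B -> riesz_inf A <= riesz_inf B.
Proof.
move=> AB; apply: le_riesz_inf => U oU BU; apply: riesz_inf_le => //.
exact: subset_trans BU.
Qed.

Lemma riesz_inf_sigma_subadditive :
  sigma_subadditive (fun A => (riesz_inf A)%:E).
Proof.
move=> F; apply/lee_addgt0Pr => e e0.
have /choice[U UP] : forall n, exists U,
    [/\ open U, F n `<=` U & rho U < riesz_inf (F n) + e / 2 ^+ n.+1].
  move=> n; have en : 0 < e / 2 ^+ n.+1 by rewrite divr_gt0// exprn_gt0.
  by have [_ [U [oU FU] <-] ?] := inf_adherent en (riesz_has_inf (F n)); exists U.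
set S := (\sum_(i <oo) _)%E.
have [Soo|Sfin] := eqVneq S +oo%E; first by rewrite Soo addye ?leey.
have S0 : (0 <= S)%E.
  by apply: nneseries_ge0 => n _ _; rewrite lee_fin riesz_inf_ge0.
have finS : S \is a fin_num by rewrite ge0_fin_numE// lt_neqAle Sfin leey.
rewrite -(fineK finS) -EFinD lee_fin.
apply: le_trans (_ : rho (\bigcup_n U n) <= _).
  apply: riesz_inf_le; first by apply: bigcup_open => n _; case: (UP n).
  by apply: subset_bigcup => n _; case: (UP n).
apply: rho_bigcup_le => [n|N]; first by case: (UP n).
have geo : \sum_(i < N) e / 2 ^+ i.+1 = e - e / 2 ^+ N.
  elim: N => [|N IH]; first by rewrite big_ord0 expr0 divr1 subrr.
  rewrite big_ord_recr/= IH exprS; field.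
  by rewrite expf_neq0.
apply: (@le_trans _ _ (\sum_(i < N) (riesz_inf (F i) + e / 2 ^+ i.+1))).
  by apply: ler_sum => i _; apply: ltW; case: (UP i).
rewrite big_split/= geo; apply: lerD; last first.
  by rewrite gerBl divr_ge0// ?exprn_ge0// ltW.
rewrite -lee_fin fineK// -sumEFin -(big_mkord xpredT (fun i => (riesz_inf (F i))%:E)).
by apply: nneseries_lim_ge => n _ _; rewrite lee_fin riesz_inf_ge0.
Qed.

(** Caratheodory's criterion for the open set [U].  Let [V] be an open set around
    [A] and [f] almost exhaust the mass of [V] inside [U].  Cut off at the small
    height [e'], [f] leaves room in [V] for every function subordinate to the part
    of [V] where [f < e'], and that part is an open set containing what lies
    outside [U] in [A]. *)
Lemma riesz_inf_split U A : open U ->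
  riesz_inf (A `&` U) + riesz_inf (A `&` ~` U) <= riesz_inf A.
Proof.
move=> oU; apply: le_riesz_inf => V oV AV; apply/ler_addgt0Pr => e e0.
(* the truncation at e' costs e' * Phi 1; the + 1 also covers Phi 1 = 0 *)
pose e' := e / (Phi (Cst1 X) + 1).
have P1 : 0 < Phi (Cst1 X) + 1 by rewrite ltr_wpDl.
have e'0 : 0 < e' by rewrite divr_gt0.
have [f Uf fe] := rho_adherent (V `&` U) e'0.
have [f' [[f'01 f'U] f'0 f'2 Pf']] := positive_part_subordinate e'0 Uf.
pose W := V `&` [set x | f x < e'].
have AW : riesz_inf (A `&` ~` U) <= rho W.
  apply: riesz_inf_le; first by apply: openI => //; exact: open_lt.
  move=> x [Ax nUx]; split; first exact: AV.
  by rewrite /= Uf.2// => -[].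
have AU : riesz_inf (A `&` U) <= rho (V `&` U).
  apply: riesz_inf_le; first exact: openI.
  by move=> x [/AV].
have W_le : rho W <= rho V - Phi f'.
  apply: rho_le => g [g01 gW]; rewrite lerBrDr -PhiD; apply: le_rho; split=> x.
    rewrite CDE; have [fx|fx] := leP (f x) e'.
      by rewrite f'0// addr0.
    by rewrite gW ?add0r//= => -[_ /=]; rewrite ltNge (ltW fx).
  move=> nVx; rewrite CDE gW => [|[]//]; rewrite add0r.
  by rewrite f'U// => -[].
have : e' * Phi (Cst1 X) + e' = e by rewrite /e'; field; rewrite gt_eqF.
move: fe Pf' W_le AU AW; set a := Phi f; set b := Phi f'; set c := e' * _; lra.
Qed.

(** The sets measurable for the outer measure form a sigma-algebra, which
    contains the open sets by [riesz_inf_split], hence all Borel sets. *)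
Lemma riesz_measure_open : exists mu : finmeas X,
  forall U, open U -> mu U = (rho U)%:E.
Proof.
have h0 : (riesz_inf set0)%:E = 0%E.
  by rewrite riesz_inf_open ?rho_set0//; exact: open0.
have hge0 A : (0 <= (riesz_inf A)%:E)%E by rewrite lee_fin riesz_inf_ge0.
have hle : {homo (fun A : set X => (riesz_inf A)%:E) : A B / A `<=` B >-> (A <= B)%E}.
  by move=> A B AB; rewrite lee_fin riesz_infS.
pose om : {outer_measure set X -> \bar R} :=
  HB.pack (fun A : set X => (riesz_inf A)%:E)
    (isOuterMeasure.Build R X _ h0 hge0 hle riesz_inf_sigma_subadditive).
have borelC : (@measurable _ (borel X)) `<=` om.-caratheodory.
  apply: smallest_sub.
    split; first exact: caratheodory_measurable_set0.
      by move=> A mA; rewrite setTD; exact: caratheodory_measurable_setC.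
    exact: caratheodory_measurable_bigcup.
  move=> U oU; apply: le_caratheodory_measurable => A.
  by rewrite -EFinD lee_fin riesz_inf_split.
pose nu (A : set (borel X)) : \bar R := om A.
have nu_additive : semi_sigma_additive nu.
  move=> F mF tF mbF.
  exact: (@caratheodory_measure_sigma_additive R X om F
    (fun n => borelC _ (mF n)) tF (borelC _ mbF)).
pose m : {measure set (borel X) -> \bar R} :=
  HB.pack nu (isMeasure.Build _ (borel X) R nu h0 (fun A => hge0 A) nu_additive).
have fin : fin_num_fun m by move=> A mA.
pose mu : finmeas X := HB.pack (m : set (borel X) -> \bar R)
  (Measure.class m) (@Measure_isFinite.Build _ (borel X) R m fin).
by exists mu => U oU; rewrite -riesz_inf_open.
Qed.

End riesz.

Section riesz_representation.
Context {R : realType} {X : compactMetricType R}.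
Local Notation C := (Cspace R X).
Implicit Types (f g d : C) (U V A : set X) (mu nu : finmeas X).

Lemma open_mu_le_pairing mu U g : open U -> (forall x, 0 <= g x) ->
  (forall x, U x -> 1 <= g x) -> fine (mu U) <= pairing g mu.
Proof.
move=> oU g0 gU.
have mU : measurable (U : set (borel X)) by exact: sub_sigma_algebra.
have fin : (\int[mu]_(x in [set: borel X]) (g x)%:E)%E \is a fin_num.
  by apply: integrable_fin_num => //; exact: C_integrable.
rewrite -lee_fin fineK ?fin_num_measure// /pairing /Rintegral fineK//.
have -> : mu U = (\int[mu]_(x in [set: borel X]) (\1_U x)%:E)%E.
  by rewrite integral_indic// setIT.
apply: ge0_le_integral => //.
- by apply/measurable_EFinP; exact: measurable_indic.
- by apply/measurable_EFinP; exact: C_measurable.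
- move=> x _; rewrite lee_fin indicE; have [|] := boolP (x \in U) => //.
  by rewrite inE => /gU.
Qed.

Lemma pairing_le_open_mu mu U g : open U -> (forall x, g x <= 1) ->
  (forall x, ~ U x -> g x <= 0) -> pairing g mu <= fine (mu U).
Proof.
move=> oU g1 gU; have mU : measurable (U : set (borel X)).
  exact: sub_sigma_algebra.
have fin : (\int[mu]_(x in [set: borel X]) (g x)%:E)%E \is a fin_num.
  by apply: integrable_fin_num => //; exact: C_integrable.
rewrite -lee_fin [leRHS]fineK ?fin_num_measure// /pairing /Rintegral fineK//.
have -> : mu U = (\int[mu]_(x in [set: borel X]) (\1_U x)%:E)%E.
  by rewrite integral_indic// setIT.
apply: le_integral => //.
- exact: C_integrable.
- by apply: integrable_indic.
- move=> x _; rewrite lee_fin indicE; have [|] := boolP (x \in U) => //.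
  by rewrite notin_setE => /gU.
Qed.

(** [U] is the increasing union of the sets [{d > 1 / (n + 1)}], and the continuous
    function [min 1 ((n + 1) d)] lies between the indicators of such a set and of
    [U]. *)
Lemma open_measure_le mu nu U : open U ->
  (forall f, pairing f mu = pairing f nu) -> (mu U <= nu U)%E.
Proof.
move=> oU munu; have [d [d0 dU]] := open_positivity_set oU.
pose F (n : nat) : set (borel X) := [set x | n.+1%:R^-1 < d x].
have oF n : open (F n : set X) by exact: open_gt.
have mF n : measurable (F n) by exact: sub_sigma_algebra.
have UF : \bigcup_n F n = U.
  apply/seteqP; split => [x [n _ Fx]|x /dU dx].
    by apply/dU; apply: lt_trans Fx; rewrite invr_gt0.
  exists (Num.truncn (d x)^-1) => //; rewrite /F /=.
  by rewrite invf_plt ?posrE// truncnS_gt.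
have ndF : nondecreasing_seq F.
  move=> m n mn; apply/subsetPset => x; apply: le_lt_trans.
  by rewrite lef_pV2 ?posrE// ler_nat.
have mU : measurable (\bigcup_n F n) by rewrite UF; exact: sub_sigma_algebra.
have := nondecreasing_cvg_mu (mu := mu) mF mU ndF; rewrite UF => cv.
rewrite -(cvg_lim _ cv)//; apply: lime_le; first by apply/cvg_ex; exists (mu U).
apply: nearW => n /=.
rewrite -(fineK (fin_num_measure mu _ (mF n))).
have mU' : measurable (U : set (borel X)) by exact: sub_sigma_algebra.
rewrite -(fineK (fin_num_measure nu _ mU')) lee_fin.
pose g : C := Cmin (Cst1 X) (n.+1%:R *: d).
have gE x : g x = Num.min 1 (n.+1%:R * d x) by [].
apply: (@le_trans _ _ (pairing g mu)).
  apply: open_mu_le_pairing => // x; rewrite gE.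
    by rewrite le_min ler01 mulr_ge0.
  rewrite /F /= => dx; rewrite le_min lexx/= mulrC -ler_pdivrMr// div1r.
  exact: ltW.
rewrite munu; apply: pairing_le_open_mu => // x; rewrite gE.
  by rewrite ge_min lexx.
move=> nUx; have -> : d x = 0.
  by apply/eqP/negPn/negP => dx; apply/nUx/dU; rewrite lt_def dx d0.
by rewrite mulr0 ge_min lexx orbT.
Qed.

Lemma measure_eq_pairing mu nu :
  (forall f, pairing f mu = pairing f nu) -> measure_eq mu nu.
Proof.
move=> munu A mA.
apply: (@measure_unique _ _ (borel X) (@open X) (fun=> setT)) => //.
- by move=> U V oU oV; exact: openI.
- by move=> _; exact: openT.
- by apply/seteqP; split => // x _; exists 0%N.
- move=> U oU; apply/eqP; rewrite eq_le.
  by apply/andP; split; apply: open_measure_le.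
- by move=> _; rewrite ltey_eq fin_num_measure.
Qed.

Section representation.
Variable Phi : C -> R.
Hypothesis PhiD : forall f g : C, Phi (f + g) = Phi f + Phi g.
Hypothesis PhiZ : forall a (f : C), Phi (a *: f) = a * Phi f.
Hypothesis Phi_ge0 : forall f : C, (forall x, 0 <= f x) -> 0 <= Phi f.

(** A number in [[0, N]] is the sum of its [N] layers of height 1. *)
Lemma clamp_sum (t : R) (N : nat) : 0 <= t <= N%:R ->
  \sum_(i < N) Num.min 1 (Num.max 0 (t - i%:R)) = t.
Proof.
suff H M : \sum_(i < M) Num.min 1 (Num.max 0 (t - i%:R)) =
    Num.min M%:R (Num.max 0 t).
  by case/andP=> t0 tN; rewrite H (max_idPr t0); apply/min_idPr.
elim: M => [|M IH].
  by rewrite big_ord0; apply/esym/min_idPl; rewrite le_max lexx.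
rewrite big_ord_recr/= IH -[in RHS]addn1 natrD.
have M0 : 0 <= M%:R :> R by [].
have [tM|Mt] := leP t M%:R.
  have -> : Num.max 0 (t - M%:R) = 0 by apply/max_idPl; rewrite subr_le0.
  have tM' : Num.max 0 t <= M%:R by rewrite ge_max M0.
  rewrite (min_idPr ler01) addr0 (min_idPr tM') (min_idPr _)//.
  by rewrite (le_trans tM')// lerDl.
have t0 : 0 <= t by rewrite (le_trans M0)// ltW.
have -> : Num.max 0 (t - M%:R) = t - M%:R by apply/max_idPr; rewrite subr_ge0 ltW.
rewrite (max_idPr t0) (min_idPl (ltW Mt)) addr_minr.
by congr (Num.min _ _); rewrite addrC subrK.
Qed.

(** Cut [N * f] into layers of height 1.  Each layer but the lowest vanishes off
    an open set on which the next lower layer equals 1, so [Phi] of the former is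
    at most the integral of the latter.  Only the lowest layer is lost, which
    costs at most [Phi 1] against a total of order [N]. *)
Lemma Phi_le_pairing mu f : (forall U, open U -> mu U = (rho Phi U)%:E) ->
  (forall x, 0 <= f x <= 1) -> Phi f <= pairing f mu.
Proof.
move=> muE f01.
have P1 : 0 <= Phi (Cst1 X) by apply: Phi_ge0 => x; rewrite C1E.
suff H (N : nat) : N%:R * Phi f <= Phi (Cst1 X) + N%:R * pairing f mu.
  apply/ler_addgt0Pr => e e0.
  pose N := (Num.truncn (Phi (Cst1 X) / e)).+1.
  have N0 : 0 < N%:R :> R by rewrite ltr0n.
  have : Phi (Cst1 X) < N%:R * e by rewrite -ltr_pdivrMr// truncnS_gt.
  by move=> h; rewrite -(ler_pM2l N0) mulrDr; apply: le_trans (H N) _; lra.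
case: N => [|N]; first by rewrite !mul0r addr0.
(* the layer of N.+1 * f between the heights i and i.+1 *)
pose c (i : nat) : C := Cmin (Cst1 X) (Cmax 0 (N.+1%:R *: f + (- i%:R) *: Cst1 X)).
have cE i x : c i x = Num.min 1 (Num.max 0 (N.+1%:R * f x - i%:R)).
  by rewrite CminE CmaxE CDE !CZE C1E C0E mulr1.
have sumc : N.+1%:R *: f = \sum_(i < N.+1) c i.
  apply: C_ext => x.
  rewrite (big_morph (fun h : C => h x) (fun _ _ => erefl) erefl)/=.
  under eq_bigr do rewrite cE.
  rewrite clamp_sum ?CZE//; have /andP[f0 f1] := f01 x.
  by rewrite mulr_ge0//= ler_piMr.
have c01 i x : 0 <= c i x <= 1.
  by rewrite cE le_min ler01 le_max lexx/= ge_min lexx.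
have step i : Phi (c i.+1) <= pairing (c i) mu.
  pose U := [set x | i.+1%:R < (N.+1%:R *: f) x].
  have oU : open U by exact: open_gt.
  apply: (@le_trans _ _ (rho Phi U)).
    apply: le_rho => //; split => // x.
    rewrite /U/= CZE => /negP; rewrite -leNgt => h; rewrite cE.
    have -> : Num.max 0 (N.+1%:R * f x - i.+1%:R) = 0.
      by apply/max_idPl; rewrite subr_le0.
    by apply/min_idPr.
  have -> : rho Phi U = fine (mu U) by rewrite muE.
  apply: open_mu_le_pairing => // x; first by case/andP: (c01 i x).
  rewrite /U/= CZE => h; rewrite cE le_min lexx/= le_max; apply/orP; right.
  by rewrite lerBrDr nat1r ltW.
have PhiS (I : nat) (F : nat -> C) : Phi (\sum_(i < I) F i) = \sum_(i < I) Phi (F i).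
  by apply: (big_morph Phi PhiD); rewrite -(scale0r (0 : C)) PhiZ mul0r.
have pairS (I : nat) (F : nat -> C) :
    pairing (\sum_(i < I) F i) mu = \sum_(i < I) pairing (F i) mu.
  apply: (big_morph (fun h => pairing h mu) (pairingD mu)).
  by rewrite -(scale0r (0 : C)) pairingZ mul0r.
rewrite -PhiZ -pairingZ sumc PhiS pairS big_ord_recl [in leRHS]big_ord_recr/=.
apply: lerD.
  by apply: le_Phi => // x; case/andP: (c01 0%N x).
apply: ler_wpDr.
  by have := @le_pairing _ _ mu 0 (c N) _; rewrite -(scale0r (0 : C)) pairingZ mul0r;
    apply => x; rewrite CZE mul0r; case/andP: (c01 N x).
by apply: ler_sum => i _; exact: step.
Qed.

(** The total masses agree, so [Phi_le_pairing] extends by affine changes from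
    functions with values in the unit interval to [Phi f <= pairing f mu] for all
    [f]; then [- f] gives equality. *)
Theorem riesz_representation : exists mu, forall f, pairing f mu = Phi f.
Proof.
have [mu muE] := riesz_measure_open PhiD PhiZ Phi_ge0.
have muT : pairing (Cst1 X) mu = Phi (Cst1 X).
  by rewrite pairing1 (muE setT openT)/= rho_setT.
have le f : Phi f <= pairing f mu.
  pose B := `|f| + 1; have B0 : 0 < B by rewrite ltr_wpDl.
  pose g := (2 * B)^-1 *: (f + B *: Cst1 X).
  have := @Phi_le_pairing mu g muE.
  rewrite /g PhiZ PhiD PhiZ pairingZ pairingD pairingZ muT ler_pM2l; last first.
    by rewrite invr_gt0 mulr_gt0.
  rewrite lerD2r; apply => x.
  rewrite CZE CDE CZE C1E mulr1 mulrC.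
  have := le_sup_norm f x; rewrite ler_norml -/(`|f|) => /andP[].
  have -> : sup_norm f = `|f| by [].
  rewrite /B => h1 h2; rewrite ler_pdivrMr ?mulr_gt0// mul1r.
  by apply/andP; split; [rewrite divr_ge0// ?mulr_ge0 ?ltW//; lra | lra].
exists mu => f; apply/eqP; rewrite eq_le le andbT.
have := le ((-1) *: f); rewrite PhiZ pairingZ; lra.
Qed.
End representation.
End riesz_representation.

(** * Iterated transfer operators as a two-parameter family *)

Lemma int_ge_ind (m : int) (P : int -> Prop) : P m ->
  (forall n, m <= n -> P n -> P (n + 1)) -> forall n, m <= n -> P n.
Proof.
move=> Pm PS n mn; have -> : n = m + `|n - m|%N%:Z by lia.
elim: `|n - m|%N => [|k IH]; first by rewrite addr0.
have -> : m + k.+1%:Z = m + k%:Z + 1 by lia.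
by apply: PS => //; lia.
Qed.

Section evolution.
Context {R : realType} {X : int -> compactMetricType R}.
Local Notation C n := (Cspace R (X n)).
Variable L : forall n, {linear C n -> C (n + 1)}.
Implicit Types (m n l : int) (k : nat).

Local Arguments castC {R X m n} e f.

(** Integers have unique proofs of equality; this is what makes transports along
    different proofs interchangeable. *)
Lemma castC_id n (e : n = n) (f : C n) : castC e f = f.
Proof. by rewrite (eq_irrelevance e erefl). Qed.

Lemma castC_comp l m n (e : l = m) (e' : m = n) (f : C l) :
  castC e' (castC e f) = castC (etrans e e') f.
Proof. by case: n / e'; case: m / e. Qed.

(** The iterates indexed by their source and target times.  Two consecutive ones
    then compose without transport, whereas the spaces at times [n + k + 1] and
    [n + (k + 1)] are only propositionally equal.  The value 0 is for targets
    before the source. *)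
Definition ev m n (f : C m) : C n :=
  if pselect (m + `|n - m|%N%:Z = n) is left e then castC e (iterL L m `|n - m| f)
  else 0.
Arguments ev : clear implicits.

Lemma evE m k n (e : m + k%:Z = n) (f : C m) :
  ev m n f = castC e (iterL L m k f).
Proof.
case: n / e; rewrite /ev.
have E : absz (m + k%:Z - m)%R = k by lia.
case: pselect => [|]; last by rewrite E.
by rewrite E => e; rewrite (eq_irrelevance e erefl).
Qed.

Lemma ev_refl n (f : C n) : ev n n f = f.
Proof. by rewrite (evE (addr0 n)) /= castC_comp castC_id. Qed.

Lemma evS m n (f : C m) : m <= n -> ev m (n + 1) f = L n (ev m n f).
Proof.
move=> mn; have e : m + `|n - m|%N%:Z = n by lia.
move: `|n - m|%N e => k e; case: n / e mn => _.
rewrite (evE (erefl (m + k%:Z))) (evE (esym (iterS_subproof m k))) /=.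
by rewrite castC_comp castC_id.
Qed.

Lemma ev_comp l m n (f : C l) : l <= m -> m <= n ->
  ev m n (ev l m f) = ev l n f.
Proof.
move=> lm; move: n; apply: int_ge_ind; first by rewrite ev_refl.
by move=> n mn IH; rewrite !evS ?IH// (le_trans lm).
Qed.

Lemma ev1 n (f : C n) : ev n (n + 1) f = L n f.
Proof. by rewrite evS// ev_refl. Qed.

Lemma evD m n (f g : C m) : m <= n -> ev m n (f + g) = ev m n f + ev m n g.
Proof.
move: n; apply: int_ge_ind; first by rewrite !ev_refl.
by move=> n mn IH; rewrite !evS// IH linearD.
Qed.

Lemma evZ m n a (f : C m) : m <= n -> ev m n (a *: f) = a *: ev m n f.
Proof.
move: n; apply: int_ge_ind; first by rewrite !ev_refl.
by move=> n mn IH; rewrite !evS// IH linearZ.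
Qed.

Lemma evB m n (f g : C m) : m <= n -> ev m n (f - g) = ev m n f - ev m n g.
Proof.
move: n; apply: int_ge_ind; first by rewrite !ev_refl.
by move=> n mn IH; rewrite !evS// IH linearB.
Qed.

Lemma evN m n (f : C m) : m <= n -> ev m n (- f) = - ev m n f.
Proof.
move: n; apply: int_ge_ind; first by rewrite !ev_refl.
by move=> n mn IH; rewrite !evS// IH linearN.
Qed.

Lemma iterL_ev n k (f : C n) : iterL L n k f = ev n (n + k%:Z) f.
Proof. by rewrite (evE (erefl (n + k%:Z))). Qed.

Lemma iterL_to_ev n k (f : C (n - k%:Z)) : iterL_to L n k f = ev (n - k%:Z) n f.
Proof. by rewrite (evE (subrK k%:Z n)). Qed.

Lemma iterL_next_ev n j (f : C (n + 1)) :
  iterL_next L n j f = ev (n + 1) (n + j.+1%:Z) f.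
Proof. by rewrite (evE (iter_next_subproof n j)). Qed.

Section positive.
Hypothesis L_ge0 : forall n (f : C n), (forall x, 0 <= f x) ->
  forall x, 0 <= L n f x.

Lemma ev_ge0 m n (f : C m) : m <= n -> (forall x, 0 <= f x) ->
  forall x, 0 <= ev m n f x.
Proof.
move=> + f0; move: n; apply: int_ge_ind; first by rewrite ev_refl.
by move=> n mn IH; rewrite evS//; exact: L_ge0.
Qed.

Lemma le_ev m n (f g : C m) : m <= n -> (forall x, f x <= g x) ->
  forall x, ev m n f x <= ev m n g x.
Proof.
move=> mn fg x; rewrite -subr_ge0 -CNE -CDE -evB//.
by apply: ev_ge0 => // y; rewrite CDE CNE subr_ge0.
Qed.

End positive.
End evolution.
Arguments ev {R X} L m n f.

(** The value of [T f] at [y] is the integral of [f] against the image of the point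
    mass at [y]. *)
Lemma dual_positive (R : realType) (X Y : compactMetricType R)
    (T : {linear Cspace R X -> Cspace R Y}) :
  dual_acts_on_measures T -> forall f : Cspace R X, (forall x, 0 <= f x) ->
  forall y, 0 <= T f y.
Proof.
move=> hT f f0 y; have [sigma Ms sE] := exists_dirac y.
by have [mu _ muE] := hT _ Ms; rewrite -sE -muE; apply: Rintegral_ge0 => x _.
Qed.

Lemma dualP (R : realType) (X Y : compactMetricType R)
    (T : Cspace R X -> Cspace R Y) sigma : dual_acts_on_measures T ->
  Mspace sigma -> is_dual T sigma (dual T sigma).
Proof.
move=> hT /hT[mu _ muE].
exact: (@xgetPex _ (mzero : finmeas X) [set nu | is_dual T sigma nu]
  (ex_intro _ mu muE)).
Qed.

Lemma dual_acts_ev (R : realType) (X : int -> compactMetricType R)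
    (L : forall n, {linear Cspace R (X n) -> Cspace R (X (n + 1))}) :
  (forall n, dual_acts_on_measures (L n)) ->
  forall m n, m <= n -> dual_acts_on_measures (ev L m n).
Proof.
move=> hL m; apply: int_ge_ind.
  by move=> sigma Ms; exists sigma => // f; rewrite ev_refl.
move=> n mn IH sigma /hL[mu /IH[nu Mnu nuE] muE]; exists nu => // f.
by rewrite nuE muE evS.
Qed.

(** * The order of a cone and its Hilbert metric *)

Section cone_order.
Context {R : realType} {V : normedModType R}.
Variable K : set V.
Hypothesis cK : convex_cone K.
Implicit Types (f g h : V) (a t : R).

Lemma coneD f g : (K `|` [set 0]) f -> (K `|` [set 0]) g ->
  (K `|` [set 0]) (f + g).
Proof.
have [_ _ KD] := cK; move=> [Kf|->] [Kg|->]; rewrite ?addr0 ?add0r.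
- by left; exact: KD.
- by left.
- by left.
- by right.
Qed.

Lemma coneZ_gt0 t f : 0 < t -> K f -> K (t *: f).
Proof. by have [_ KZ _] := cK => t0 Kf; rewrite -(KZ t t0); exists f. Qed.

Lemma coneZ t f : 0 <= t -> (K `|` [set 0]) f -> (K `|` [set 0]) (t *: f).
Proof.
rewrite le_eqVlt => /predU1P[<-|t0] [Kf|->]; rewrite ?scale0r ?scaler0;
  try by right.
by left; exact: coneZ_gt0.
Qed.

Lemma cone_le_trans f g h : cone_le K f g -> cone_le K g h -> cone_le K f h.
Proof.
move=> fg gh; rewrite /cone_le.
have -> : h - f = (g - f) + (h - g) by rewrite [RHS]addrC addrA subrK.
exact: coneD.
Qed.

Lemma cone_leZr f a t : a <= t -> K f -> cone_le K (a *: f) (t *: f).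
Proof.
by move=> at_ Kf; rewrite /cone_le -scalerBl; apply: coneZ; [rewrite subr_ge0|left].
Qed.
End cone_order.

Section hilbert.
Context {R : realType} {X : compactMetricType R}.
Local Notation C := (Cspace R X).
Variable K : set C.
Hypothesis cK : convex_cone K.
Hypothesis KC : K `<=` Cplus X.
Implicit Types (f g : C) (x : X).

Lemma Cplus_gt0 f : Cplus X f -> exists x, 0 < f x.
Proof.
move=> [f0 fn0]; apply: contrapT => nf; apply: fn0; apply/funext => x.
apply/eqP/negPn/negP => fx; apply: nf; exists x.
by rewrite lt_def fx f0.
Qed.

Lemma cone_le_pointwise f g : cone_le K f g -> forall x, f x <= g x.
Proof.
move=> [/KC[h _] x|/= h x]; first by have := h x; rewrite CDE CNE subr_ge0.
by move/eqP: h; rewrite subr_eq0 => /eqP ->.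
Qed.

(** With [cone_A_lty], this excludes the degenerate values of [B / A], for which a
    bound on its logarithm would say nothing. *)
Lemma cone_B_gt0 g f : K g -> K f -> (0 < cone_B K g f)%E.
Proof.
move=> /KC Kg /KC /Cplus_gt0[x fx].
have g0 : 0 < `|g| + 1 by rewrite ltr_wpDl.
apply: (@lt_le_trans _ _ (f x / (`|g| + 1))%:E); first by rewrite lte_fin divr_gt0.
apply: le_ereal_inf_tmp => _ [t [t0 /cone_le_pointwise/(_ x) h] <-].
rewrite lee_fin ler_pdivrMr//; apply: le_trans h _; rewrite CZE.
rewrite ler_pM2l//; apply: le_trans (ler_norm _) _.
by apply: le_trans (le_sup_norm g x) _; rewrite lerDl.
Qed.

Lemma cone_A_lty g f : K g -> K f -> (cone_A K g f < +oo)%E.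
Proof.
move=> /KC/Cplus_gt0[x gx] /KC[f0 _].
apply: (@le_lt_trans _ _ (f x / g x)%:E); last exact: ltry.
apply: ge_ereal_sup => _ [->|[t [t0 /cone_le_pointwise/(_ x) h] <-]].
  by rewrite lee_fin divr_ge0// ltW.
by rewrite lee_fin ler_pdivlMr//; rewrite CZE in h.
Qed.

(** The extra factor [e] in the constant pays for replacing the extrema [A] and
    [B] by elements of the sets that define them. *)
Lemma hilbert_comparable (S : set C) (D : R) g f : S `<=` K ->
  (hilbert_diam K S <= D%:E)%E -> S g -> S f ->
  exists2 a, 0 < a &
    cone_le K (a *: g) f /\ cone_le K f ((expR (D + 1) * a) *: g).
Proof.
move=> SK diam Sg Sf; have Kg := SK _ Sg; have Kf := SK _ Sf.
have : (hilbert_metric K g f <= D%:E)%E.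
  by apply: le_trans diam; apply: ereal_sup_ubound; exists (g, f).
rewrite /hilbert_metric.
have B0 := cone_B_gt0 Kg Kf; have Aoo := cone_A_lty Kg Kf.
have A0 : (0 <= cone_A K g f)%E by apply: ereal_sup_ubound; left.
have EA : cone_A K g f = ereal_sup (0%E |` [set t%:E | t in [set t : R | (0 < t)%R /\
                                    cone_le K (t *: g)%R f]]) by [].
have EB : cone_B K g f = ereal_inf [set t%:E | t in [set t : R | (0 < t)%R /\
                                    cone_le K f (t *: g)%R]] by [].
move: B0 Aoo A0 EA EB.
set B := cone_B K g f; set A := cone_A K g f; clearbody A B.
move=> B0 Aoo A0 EA EB; rewrite -lee_expeR lneK; last first.
  by rewrite in_itv/= leey andbT mule_ge0 ?inve_ge0// ltW.
case: A A0 Aoo EA => // r; rewrite lee_fin le_eqVlt => /predU1P[<- _ _|r0 _ EA].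
  by rewrite inve0 gt0_muley.
rewrite inver gt_eqF// lee_pdivrMr//= -EFinM => Ble.
have : ((expR (-1) * r)%:E < ereal_sup (0%E |` [set t%:E | t in [set t : R | (0 < t)%R /\
                                    cone_le K (t *: g)%R f]]))%E.
  by rewrite -EA lte_fin gtr_pMl// -[ltRHS]expR0 ltr_expR ltrN10.
move=> /ereal_sup_gt[_ [->|[a [a0 ag] <-]]].
  by rewrite lte_fin => /(lt_trans (mulr_gt0 (expR_gt0 _) r0)); rewrite ltxx.
(* B <= e^D A and A < e a, so some b < e^(D+1) a satisfies f <= b g *)
rewrite lte_fin => ra; exists a => //; split => //.
have : (B < (expR (D + 1) * a)%:E)%E.
  apply: le_lt_trans Ble _; rewrite lte_fin expRD -mulrA ltr_pM2l ?expR_gt0//.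
  by rewrite -(ltr_pM2l (expR_gt0 (-1))) mulrA -expRD addNr expR0 mul1r.
rewrite EB => /ereal_inf_lt[_ [b [b0 fb] <-]]; rewrite lte_fin => /ltW bb.
by apply: (cone_le_trans cK) fb _; exact: cone_leZr.
Qed.
End hilbert.

(** * Contraction of order intervals *)

Lemma bernoulli_ineq (R : realDomainType) (t : R) (n : nat) : 0 <= t <= 1 ->
  1 - n%:R * t <= (1 - t) ^+ n.
Proof.
move=> /andP[t0 t1]; elim: n => [|n IH]; first by rewrite mul0r subr0 expr0.
rewrite exprS; apply: (@le_trans _ _ ((1 - t) * (1 - n%:R * t))).
  have : 0 <= n%:R * t ^+ 2 by rewrite mulr_ge0 ?sqr_ge0.
  by rewrite -natr1; lra.
by apply: ler_wpM2l => //; rewrite subr_ge0.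
Qed.

Section dynamics.
Context {R : realType} {X : int -> compactMetricType R}.
Local Notation C n := (Cspace R (X n)).
Variable L : forall n, {linear C n -> C (n + 1)}.
Variable Lam : forall n, set (C n).
Arguments Lam : clear implicits.
Variables (kappa Delta : R) (tau : nat).
Hypothesis hdual : forall n : int, dual_acts_on_measures (L n).
Hypothesis hC1 : condC1 Lam.
Hypothesis hC2 : condC2 L Lam kappa Delta tau.
Hypothesis hC3 : condC3 L Lam.
Implicit Types (m n p : int) (k : nat).
Local Notation one n := (Cst1 (X n)).

Let L_ge0 n (f : C n) (f0 : forall x, 0 <= f x) x : 0 <= L n f x :=
  dual_positive (@hdual n) f0 x.
Let leE := le_ev L_ge0.

Lemma Lam_cone n : convex_cone (Lam n).
Proof. by have [[]] := @hC1 n. Qed.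

Lemma Lam_Cplus n : Lam n `<=` Cplus (X n).
Proof. by have [] := @hC1 n. Qed.

Lemma Lam1 n : Lam n (one n).
Proof. by have [] := @hC1 n. Qed.

Lemma ev_Lam m n f : m <= n -> Lam m f -> Lam n (ev L m n f).
Proof.
move=> + Lf; move: n; apply: int_ge_ind; first by rewrite ev_refl.
move=> n mn IH; rewrite evS//; have [/(_ n)[_ LL] _ _ _] := hC2.
by apply: LL; exists (ev L m n f).
Qed.

Lemma cone_le_ev m n f g : m <= n -> cone_le (Lam m) f g ->
  cone_le (Lam n) (ev L m n f) (ev L m n g).
Proof.
move=> mn; rewrite /cone_le.
rewrite -evB// => -[Kfg|/= ->]; [left; exact: ev_Lam|right].
by rewrite /= -(scale0r (0 : C m)) evZ// scale0r.
Qed.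

Let M := expR (Delta + 1).
Let M_gt1 : 1 < M.
Proof. by rewrite expR_gt1 ltr_wpDl// ltW//; have [] := hC2. Qed.
Let M_gt0 : 0 < M. Proof. exact: lt_trans M_gt1. Qed.

Lemma tau_comparable m n f g : m + tau%:Z <= n -> Lam m f -> Lam m g ->
  exists2 a, 0 < a & cone_le (Lam n) (a *: ev L m n g) (ev L m n f) /\
    cone_le (Lam n) (ev L m n f) ((M * a) *: ev L m n g).
Proof.
move=> mn Kf Kg; have [p [pE mp]] : exists p, n = p + tau%:Z /\ m <= p.
  by exists (n - tau%:Z); split; lia.
rewrite {}pE in mn *; have [_ _ _ /(_ p)[diam _]] := hC2.
have pp : p <= p + tau%:Z by lia.
apply: (hilbert_comparable (Lam_cone _) (@Lam_Cplus _) _ diam).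
- by move=> _ [u Ku <-]; rewrite iterL_ev; exact: ev_Lam.
- by exists (ev L m p g); [exact: ev_Lam|rewrite iterL_ev ev_comp].
- by exists (ev L m p f); [exact: ev_Lam|rewrite iterL_ev ev_comp].
Qed.

Let q := 1 - M^-1.
Let q_ge0 : 0 <= q. Proof. by rewrite subr_ge0 invf_le1// ltW. Qed.
Let q_lt1 : q < 1. Proof. by rewrite ltrBlDr ltrDl invr_gt0. Qed.

(** Both [u = f - a g] and [v = b g - f] are in the cone, unless one of them is 0
    and the interval collapses.  After [tau] steps [u >= c g] and [v >= d g], where
    [u <= M c g] and [v <= M d g] as well; adding the last two gives
    [b - a <= M (c + d)], and [a + c], [b - d] are the new ends. *)
Lemma contraction_step m n f g a b : m + tau%:Z <= n -> Lam m f -> Lam m g ->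
  a <= b -> cone_le (Lam m) (a *: g) f -> cone_le (Lam m) f (b *: g) ->
  exists a' b', [/\ a <= a', a' <= b', b' - a' <= q * (b - a),
    cone_le (Lam n) (a' *: ev L m n g) (ev L m n f)
    & cone_le (Lam n) (ev L m n f) (b' *: ev L m n g)].
Proof.
move=> mn Kf Kg ab agf fbg.
have mn' : m <= n by apply: le_trans mn; lia.
have q0 : 0 <= q * (b - a) by rewrite mulr_ge0// subr_ge0.
have refl c : cone_le (Lam n) (c *: ev L m n g) (c *: ev L m n g).
  by right; rewrite /= subrr.
case: (agf) => [Ku|/eqP]; last first.
  rewrite subr_eq0 => /eqP fE; exists a, a; rewrite subrr lexx.
  by split=> //; rewrite fE evZ.
case: (fbg) => [Kv|/eqP]; last first.
  rewrite subr_eq0 => /eqP fE; exists b, b; rewrite subrr lexx.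
  by split=> //; rewrite -fE evZ.
have [c c0 [uc1 uc2]] := tau_comparable mn Ku Kg.
have [d d0 [vd1 vd2]] := tau_comparable mn Kv Kg.
have [x gx] := Cplus_gt0 (Lam_Cplus (ev_Lam mn' Kg)).
have evu : ev L m n (f - a *: g) = ev L m n f - a *: ev L m n g.
  by rewrite evB// evZ.
have evv : ev L m n (b *: g - f) = b *: ev L m n g - ev L m n f.
  by rewrite evB// evZ.
rewrite {}evu in uc1 uc2; rewrite {}evv in vd1 vd2.
have pw := cone_le_pointwise (@Lam_Cplus n).
have := pw _ _ uc1 x; have := pw _ _ uc2 x; have := pw _ _ vd1 x.
have := pw _ _ vd2 x; move: {pw}(gx); rewrite !(CDE, CNE, CZE).
set G := ev L m n g x; set F := ev L m n f x => G0 h1 h2 h3 h4.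
have bacd : c + d <= b - a.
  rewrite -(ler_pM2r G0); lra.
have baM : b - a <= M * (c + d).
  rewrite -(ler_pM2r G0); lra.
exists (a + c), (b - d); split.
- by rewrite lerDl ltW.
- by lra.
- have -> : q * (b - a) = (b - a) - M^-1 * (b - a) by rewrite /q; ring.
  have : M^-1 * (b - a) <= c + d by rewrite mulrC ler_pdivrMr// mulrC.
  by lra.
- have -> : (a + c) *: ev L m n g = a *: ev L m n g + c *: ev L m n g.
    by rewrite scalerDl.
  by move: uc1; rewrite /cone_le opprD addrA.
- have -> : (b - d) *: ev L m n g = b *: ev L m n g - d *: ev L m n g.
    by rewrite scalerBl.
  by move: vd1; rewrite /cone_le addrAC.
Qed.

Lemma contraction_iter m n (j : nat) f g :
  m + tau%:Z + (j * tau.+1)%N%:Z <= n -> Lam m f -> Lam m g ->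
  exists a b, [/\ 0 < a, a <= b, b - a <= q ^+ j * (M - 1) * a,
    cone_le (Lam n) (a *: ev L m n g) (ev L m n f)
    & cone_le (Lam n) (ev L m n f) (b *: ev L m n g)].
Proof.
move=> + Kf Kg; elim: j n => [|j IH] n mn.
  have mn' : m + tau%:Z <= n by lia.
  have [a a0 [h1 h2]] := tau_comparable mn' Kf Kg.
  exists a, (M * a); split => //; first by rewrite ler_peMl ?ltW.
  by rewrite expr0 mul1r mulrBl mul1r.
have mn' : m + tau%:Z + (j * tau.+1)%N%:Z <= n - tau.+1%:Z by lia.
have mle : m <= n - tau.+1%:Z by lia.
have [a [b [a0 ab ba h1 h2]]] := IH _ mn'.
have step : n - tau.+1%:Z + tau%:Z <= n by clear; lia.
have [a' [b' [aa' ab' ba' h1' h2']]] :=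
  contraction_step step (ev_Lam mle Kf) (ev_Lam mle Kg) ab h1 h2.
have nle : n - tau.+1%:Z <= n by clear; lia.
rewrite !ev_comp// in h1' h2'.
exists a', b'; split => //; first exact: lt_le_trans aa'.
apply: le_trans ba' _; rewrite exprS -!mulrA; apply: ler_wpM2l => //.
apply: le_trans ba _; rewrite -mulrA; apply: ler_wpM2l; first exact: exprn_ge0.
by apply: ler_wpM2l => //; rewrite subr_ge0 ltW.
Qed.

(** Blocks of [tau + 1] steps, rather than [tau], so that blocks are nontrivial even
    for [tau = 0].  The first [tau] steps and the incomplete last block amount to at
    most [2 tau] steps, whence the power of [gam] in the constant. *)
Lemma contraction : exists K0 gam, [/\ 0 < K0, 0 < gam < 1 &
  forall m (k : nat) n f g, n = m + k%:Z -> (tau <= k)%N -> Lam m f -> Lam m g ->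
  exists a b, [/\ 0 < a, a <= b, b - a <= K0 * gam ^+ k * a,
    cone_le (Lam n) (a *: ev L m n g) (ev L m n f)
    & cone_le (Lam n) (ev L m n f) (b *: ev L m n g)]].
Proof.
(* chosen so that Bernoulli's inequality gives q <= (1 - t) ^+ tau.+1 *)
pose t := M^-1 / tau.+1%:R.
have t0 : 0 < t by rewrite divr_gt0// invr_gt0.
have M1 : M^-1 < 1 by rewrite invf_lt1.
have t1 : t < 1.
  rewrite /t ltr_pdivrMr// mul1r; apply: lt_le_trans M1 _.
  by rewrite ler1n.
pose gam := 1 - t; have g0 : 0 < gam by rewrite subr_gt0.
have g1 : gam < 1 by rewrite ltrBlDr ltrDl.
have qg : q <= gam ^+ tau.+1.
  apply: le_trans (bernoulli_ineq tau.+1 _); last by rewrite !ltW.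
  by rewrite /t mulrC divfK.
pose K0 := (M - 1) / gam ^+ (2 * tau).
have K00 : 0 < K0 by rewrite divr_gt0 ?exprn_gt0// subr_gt0.
exists K0, gam; split; rewrite ?g0// => m k n f g nE tk Kf Kg.
(* whole blocks that fit after the first tau steps *)
pose j := ((k - tau) %/ tau.+1)%N.
have jE : (k <= tau.+1 * j + 2 * tau)%N.
  have := divn_eq (k - tau) tau.+1; have := ltn_pmod (k - tau) (ltn0Sn tau).
  rewrite -/j mulnC; move: tk; clear.
  by move: (j * tau.+1)%N ((k - tau) %% tau.+1)%N; lia.
have jle : (j * tau.+1 <= k - tau)%N by exact: leq_divM.
have mn : m + tau%:Z + (j * tau.+1)%N%:Z <= n.
  by rewrite nE; move: tk jle; clear; move: (j * tau.+1)%N; lia.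
have [a [b [a0 ab ba h1 h2]]] := contraction_iter mn Kf Kg.
exists a, b; split => //; apply: le_trans ba _; apply: ler_wpM2r; first exact: ltW.
rewrite /K0 mulrC -!mulrA; apply: ler_wpM2l; first by rewrite subr_ge0 ltW.
rewrite mulrC ler_pdivlMr ?exprn_gt0//.
apply: (@le_trans _ _ (gam ^+ (tau.+1 * j) * gam ^+ (2 * tau))).
  apply: ler_wpM2r; first by rewrite exprn_ge0// ltW.
  by rewrite exprM; apply: lerXn2r => //; rewrite nnegrE// exprn_ge0// ltW.
rewrite -exprD; apply: ler_wiXn2l => //; exact: ltW.
Qed.

(** * Limits of the ratios of iterates *)

Lemma ev1_ge_cst m n : m <= n -> exists2 c, 0 < c &
  forall x, c <= ev L m n (one m) x.
Proof.
have [_ [k1 /= hk] _ _] := hC2; have k0 : 0 < kappa by exact: lt_le_trans k1.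
move: n; apply: int_ge_ind; first by exists 1 => // x; rewrite ev_refl C1E.
move=> n mn [c c0 IH]; exists (c / kappa); first by rewrite divr_gt0.
move=> x; rewrite evS//; have [/(_ x)/andP[Lx _] _] := hk n.
apply: (@le_trans _ _ ((c *: L n (one n)) x)).
  by rewrite CZE; apply: ler_wpM2l => //; exact: ltW.
rewrite -linearZ -!ev1; apply: leE => [|y]; first by lia.
by rewrite CZE C1E mulr1.
Qed.

Lemma ev1_gt0 m n x : m <= n -> 0 < ev L m n (one m) x.
Proof. by move=> /ev1_ge_cst[c c0 h]; exact: lt_le_trans (h x). Qed.

Lemma ev_norm m n f x : m <= n ->
  `|ev L m n f x| <= `|f| * ev L m n (one m) x.
Proof.
move=> mn; rewrite -CZE -evZ// ler_norml -CNE.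
have fx y : `|f y| <= `|f| by exact: le_sup_norm.
rewrite -evN//; apply/andP; split; apply: leE => // y; rewrite ?CNE CZE C1E mulr1;
  by have := fx y; rewrite ler_norml => /andP[].
Qed.

(** The quotient of the iterates of [f] and of 1 tends to [l], uniformly over the
    space.  The error is stated relative to the iterates of 1, so that it survives
    positive operators and integration; the threshold is an absolute time, so
    that statements with different starting times [m] combine. *)
Definition close m (f : C m) (l : R) : Prop := forall e, 0 < e ->
  exists N : int, forall n, N <= n -> m <= n -> forall x,
  `|ev L m n f x - l * ev L m n (one m) x| <= e * ev L m n (one m) x.

Lemma close_ge m f l a N : close f l ->
  (forall n, N <= n -> m <= n -> forall x,
     a * ev L m n (one m) x <= ev L m n f x) -> a <= l.
Proof.
move=> fl h; apply/ler_addgt0Pr => e /fl[N' hN'].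
pose n := Num.max m (Num.max N N').
have mn : m <= n by rewrite le_max lexx.
have Nn : N <= n by rewrite !le_max lexx !orbT.
have N'n : N' <= n by rewrite !le_max lexx !orbT.
have W0 := ev1_gt0 point mn.
rewrite -(ler_pM2r W0); apply: le_trans (h _ Nn mn point) _.
have := hN' _ N'n mn point; rewrite ler_norml => /andP[_]; lra.
Qed.

Lemma close_le m f l b N : close f l ->
  (forall n, N <= n -> m <= n -> forall x,
     ev L m n f x <= b * ev L m n (one m) x) -> l <= b.
Proof.
move=> fl h; apply/ler_addgt0Pr => e /fl[N' hN'].
pose n := Num.max m (Num.max N N').
have mn : m <= n by rewrite le_max lexx.
have Nn : N <= n by rewrite !le_max lexx !orbT.
have N'n : N' <= n by rewrite !le_max lexx !orbT.
have W0 := ev1_gt0 point mn.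
rewrite -(ler_pM2r W0).
have := h _ Nn mn point.
have := hN' _ N'n mn point; rewrite ler_norml => /andP[+ _]; lra.
Qed.

Lemma close_uniq m (f : C m) l l' : close f l -> close f l' -> l = l'.
Proof.
suff H a b : close f a -> close f b -> a <= b.
  by move=> fl fl'; apply/eqP; rewrite eq_le !H.
move=> fa fb; apply/ler_addgt0Pr => e e0; have [N hN] := fb e e0.
apply: (close_le fa (N := N)) => n Nn mn x.
have := hN n Nn mn x; rewrite ler_norml => /andP[_]; lra.
Qed.

(** The limit is the supremum of the constants that eventually bound the quotient
    from below. *)
Lemma close_cauchy m (f : C m) : (forall e, 0 < e -> exists a (N : int),
    forall n, N <= n -> m <= n -> forall x,
    `|ev L m n f x - a * ev L m n (one m) x| <= e * ev L m n (one m) x) ->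
  exists l, close f l.
Proof.
move=> h; pose S := [set b | exists N : int, forall n, N <= n -> m <= n ->
  forall x, b * ev L m n (one m) x <= ev L m n f x].
have key e : 0 < e -> exists a N, [/\ S (a - e), ubound S (a + e) &
    forall n, N <= n -> m <= n -> forall x,
    `|ev L m n f x - a * ev L m n (one m) x| <= e * ev L m n (one m) x].
  move=> e0; have [a [N hN]] := h e e0; exists a, N; split => //.
    exists N => n Nn mn x.
    by have := hN n Nn mn x; rewrite ler_norml => /andP[+ _]; lra.
  move=> b [N' hN']; pose n := Num.max m (Num.max N N').
  have mn : m <= n by rewrite le_max lexx.
  have Nn : N <= n by rewrite !le_max lexx !orbT.
  have N'n : N' <= n by rewrite !le_max lexx !orbT.
  rewrite -(ler_pM2r (ev1_gt0 point mn)).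
  have := hN' _ N'n mn point.
  by have := hN _ Nn mn point; rewrite ler_norml => /andP[_]; lra.
have S0 : has_sup S.
  by have [a [N [Sa Ua _]]] := key 1 ltr01; split; [exists (a - 1)|exists (a + 1)].
exists (sup S) => e e0; have e20 : 0 < e / 2 by rewrite divr_gt0.
have [a [N [Sa Ua hN]]] := key _ e20; exists N => n Nn mn x.
have la : a - e / 2 <= sup S by apply: (ub_le_sup S0.2).
have lb : sup S <= a + e / 2 by apply: (ge_sup S0.1).
have W0 := ev1_gt0 x mn.
have := ler_wpM2r (ltW W0) la; have := ler_wpM2r (ltW W0) lb.
have := hN n Nn mn x; rewrite !ler_norml => /andP[h1 h2] h3 h4.
by apply/andP; split; lra.
Qed.

Lemma close1 m : close (one m) 1.
Proof.
move=> e e0; exists m => n _ mn x; rewrite mul1r subrr normr0.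
by rewrite mulr_ge0// ltW// ev1_gt0.
Qed.

Lemma closeD m (f g : C m) a b : close f a -> close g b -> close (f + g) (a + b).
Proof.
move=> fa gb e e0; have e20 : 0 < e / 2 by rewrite divr_gt0.
have [N hN] := fa _ e20; have [N' hN'] := gb _ e20.
exists (Num.max N N') => n; rewrite ge_max => /andP[Nn N'n] mn x.
have := hN n Nn mn x; have := hN' n N'n mn x.
rewrite evD// CDE !ler_norml => /andP[h1 h2] /andP[h3 h4].
by apply/andP; split; lra.
Qed.

Lemma closeZ m c (f : C m) a : close f a -> close (c *: f) (c * a).
Proof.
move=> fa e e0; have c0 : 0 < `|c| + 1 by rewrite ltr_wpDl.
have [|N hN] := fa (e / (`|c| + 1)); first by rewrite divr_gt0.
exists N => n Nn mn x; rewrite evZ// CZE -mulrA -mulrBr normrM.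
apply: le_trans (ler_wpM2l (normr_ge0 c) (hN n Nn mn x)) _.
rewrite mulrA; apply: ler_wpM2r; first by rewrite ltW// ev1_gt0.
by rewrite mulrCA ler_piMr ?ltW// ltr_pdivrMr// mul1r ltrDl.
Qed.

(** Multiplicativity of the limits under a change of starting time: the quotient
    of [f] by 1 from time [p] on is the product of the quotient of [f] by 1 and of 1
    (started at [m]) by 1 (started at [p]). *)
Lemma close_push m p f l l' : m <= p -> close f l -> close (ev L m p (one m)) l' ->
  close (ev L m p f) (l' * l).
Proof.
move=> mp fl fl' e e0; pose c := 1 + `|l'| + `|l|.
have c0 : 0 < c by rewrite ltr_wpDr// ltr_wpDr.
(* d <= 1 bounds W by (|l'| + 1) W', and then the total error is d * c * W' *)
pose d := Num.min 1 (e / c).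
have d0 : 0 < d by rewrite lt_min ltr01 divr_gt0.
have d1 : d <= 1 by rewrite ge_min lexx.
have de : d * c <= e by rewrite -ler_pdivlMr// ge_min lexx orbT.
have [N hN] := fl _ d0; have [N' hN'] := fl' _ d0.
exists (Num.max N N') => n; rewrite ge_max => /andP[Nn N'n] pn x.
have mn := le_trans mp pn.
have := hN n Nn mn x; have := hN' n N'n pn x; rewrite !ev_comp//.
have := ev1_gt0 x pn; set F := ev L m n f x.
set W := ev L m n (one m) x; set W' := ev L p n (one p) x => W'0 h1 h2.
have WW' : W <= (`|l'| + 1) * W'.
  have := ler_norm l'; rewrite -(ler_pM2r W'0).
  move: h1; rewrite ler_norml => /andP[_ h1].
  have := ler_wpM2r (ltW W'0) d1; lra.
have -> : F - l' * l * W' = (F - l * W) + l * (W - l' * W') by ring.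
apply: le_trans (ler_normD _ _) _; rewrite normrM.
have h3 := ler_wpM2l (normr_ge0 l) h1.
have h4 := ler_wpM2l (ltW d0) WW'.
have h5 := ler_wpM2r (ltW W'0) de.
apply: le_trans h5; rewrite /c; lra.
Qed.

(** Conversely, the quotient from time [m] on is the quotient of the two quotients
    from time [p] on. *)
Lemma close_pull m p f l l' : m <= p -> close (ev L m p f) l ->
  close (ev L m p (one m)) l' -> 0 < l' -> close f (l / l').
Proof.
move=> mp fl fl' l'0 e e0; pose c := 1 + `|l / l'|.
have c0 : 0 < c by rewrite ltr_wpDr.
(* d <= l' / 2 bounds W' by 2 W / l', and then the total error is d * c * W' *)
pose d := Num.min (l' / 2) (e * l' / (2 * c)).
have d0 : 0 < d by rewrite lt_min !divr_gt0 ?mulr_gt0.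
have d1 : d <= l' / 2 by rewrite ge_min lexx.
have de : d * (2 * c) <= e * l' by rewrite -ler_pdivlMr ?mulr_gt0// ge_min lexx orbT.
have [N hN] := fl _ d0; have [N' hN'] := fl' _ d0.
exists (Num.max p (Num.max N N')) => n; rewrite !ge_max => /andP[pn /andP[Nn N'n]] mn x.
have := hN n Nn pn x; have := hN' n N'n pn x; rewrite !ev_comp//.
have := ev1_gt0 x pn; set F := ev L m n f x.
set W := ev L m n (one m) x; set W' := ev L p n (one p) x => W'0 h1 h2.
have WW' : l' * W' <= 2 * W.
  move: h1; rewrite ler_norml => /andP[h1 _].
  have := ler_wpM2r (ltW W'0) d1; lra.
have -> : F - l / l' * W = (F - l * W') + (l / l') * (l' * W' - W).
  by rewrite mulrBr mulrA divfK ?gt_eqF//; ring.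
apply: le_trans (ler_normD _ _) _; rewrite normrM [`|l' * W' - W|]distrC.
have h3 := ler_wpM2l (normr_ge0 (l / l')) h1.
have h5 : d * c * W' <= e * W.
  have := ler_wpM2r (ltW W'0) de; have := ler_wpM2l (ltW e0) WW'; lra.
apply: le_trans h5; rewrite /c; lra.
Qed.

(** Order intervals persist under the positive iterates, so the interval reached
    after [k] steps also bounds the quotients at all later times. *)
Definition contraction_rate (K0 gam : R) : Prop :=
  [/\ 0 < K0, 0 < gam < 1 &
  forall m (k : nat) f g, (tau <= k)%N -> Lam m f -> Lam m g ->
  exists a b, [/\ 0 < a, a <= b, b - a <= K0 * gam ^+ k * a &
    forall n, m + k%:Z <= n -> forall x,
      a * ev L m n g x <= ev L m n f x <= b * ev L m n g x]].

Lemma contraction_rate_exists : exists K0 gam, contraction_rate K0 gam.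
Proof.
have [K0 [gam [K00 g01 h]]] := contraction.
exists K0, gam; split => // m k f g tk Kf Kg.
have [a [b [a0 ab ba h1 h2]]] := h m k _ f g erefl tk Kf Kg.
exists a, b; split => // n kn x; have mk : m <= m + k%:Z by clear; lia.
have pw := cone_le_pointwise (@Lam_Cplus n).
have := pw _ _ (cone_le_ev kn h1) x; have := pw _ _ (cone_le_ev kn h2) x.
by rewrite !evZ// !ev_comp// !CZE => -> ->.
Qed.

Variables (K0 gam : R).
Hypothesis hrate : contraction_rate K0 gam.

Let K0_gt0 : 0 < K0. Proof. by have [] := hrate. Qed.
Let gam_gt0 : 0 < gam. Proof. by have [_ /andP[]] := hrate. Qed.
Let gam_lt1 : gam < 1. Proof. by have [_ /andP[]] := hrate. Qed.

Lemma rate_small (c e : R) : 0 < e -> exists2 k, (tau <= k)%N & c * gam ^+ k < e.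
Proof.
move=> e0.
have : (fun k => c * gam ^+ k) @ \oo --> c * 0.
  apply: cvgM; first exact: cvg_cst.
  by apply: cvg_expr; rewrite gtr0_norm.
rewrite mulr0 => /cvgrPdist_lt/(_ e e0)[k _ h].
exists (maxn tau k); first exact: leq_maxl.
have := h (maxn tau k) (leq_maxr _ _); rewrite /= sub0r normrN.
exact: le_lt_trans (ler_norm _).
Qed.

Lemma close_Lam m f : Lam m f -> exists l, close f l.
Proof.
move=> Kf; apply: close_cauchy => e e0.
have [k tk ke] := rate_small (K0 * `|f|) e0.
have [_ _ /(_ m k f (one m) tk Kf (Lam1 m))[a [b [a0 ab ba h]]]] := hrate.
exists a, (m + k%:Z) => n kn mn x.
have W0 := ev1_gt0 x mn.
have af : a <= `|f|.
  rewrite -(ler_pM2r W0); have /andP[+ _] := h n kn x; move=> /le_trans; apply.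
  by apply: le_trans (ler_norm _) _; exact: ev_norm.
have /andP[h1 h2] := h n kn x; rewrite ger0_norm ?subr_ge0//.
apply: (@le_trans _ _ ((b - a) * ev L m n (one m) x)); first by rewrite mulrBl lerB.
apply: ler_wpM2r; first exact: ltW.
apply: le_trans ba _; apply/ltW/(le_lt_trans _ ke); rewrite [leRHS]mulrAC.
by apply: ler_wpM2l => //; rewrite mulr_ge0 ?exprn_ge0// ltW.
Qed.

Lemma close_Lam_gt0 m f l : Lam m f -> close f l -> 0 < l.
Proof.
move=> Kf fl; have [_ _ /(_ m tau f (one m) (leqnn _) Kf (Lam1 m))] := hrate.
move=> [a [b [a0 _ _ h]]]; apply: lt_le_trans a0 _.
by apply: (close_ge fl (N := m + tau%:Z)) => n kn mn x; have /andP[] := h n kn x.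
Qed.

Lemma close_Lam_infty m f : Lam_infty L Lam m f -> exists l, close f l.
Proof.
move=> [k _ [_ Kf]]; rewrite iterL_ev in Kf; have mk : m <= m + k%:Z by clear; lia.
have [l fl] := close_Lam Kf; have K1 := ev_Lam mk (Lam1 m).
have [l' fl'] := close_Lam K1.
by exists (l / l'); apply: (close_pull mk fl fl'); exact: close_Lam_gt0 fl'.
Qed.

(** The quotient changes by at most the norm of the change of [f], so that the
    existence of limits passes to the closure of [Lam_infty - Lam_infty]. *)
Lemma close_exists m (f : C m) : exists l, close f l.
Proof.
apply: close_cauchy => e e0; have e20 : 0 < e / 2 by rewrite divr_gt0.
have ne : (ball f (e / 2))° !=set0 by exists f; exact: nbhsx_ballx.
have [h [/interior_subset fg [g1 Kg1 [g2 Kg2 gE]]]] :=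
  @hC3 m _ ne (@open_interior _ _).
rewrite -gE -ball_normE /ball_/= in fg.
have [l1 gl1] := close_Lam_infty Kg1; have [l2 gl2] := close_Lam_infty Kg2.
have [N hN] := closeD gl1 (closeZ (-1) gl2) e20.
exists (l1 + -1 * l2), N => n Nn mn x; have := hN n Nn mn x.
have W0 := ev1_gt0 x mn.
have := ev_norm (f - (g1 - g2)) x mn; rewrite evB// CDE CNE scaleN1r.
have := ler_wpM2r (ltW W0) (ltW fg).
set W := ev _ _ _ (one m) x; set F := ev _ _ _ f x; set G := ev _ _ _ (g1 - g2) x.
move=> h1 h2 h3.
have -> : F - (l1 + -1 * l2) * W = (F - G) + (G - (l1 + -1 * l2) * W) by ring.
apply: le_trans (ler_normD _ _) _; lra.
Qed.

(** This functional will turn out to be integration against [m_n]. *)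
Definition Phi m (f : C m) : R := xget 0 [set l | close f l].

Lemma closePhi m (f : C m) : close f (Phi f).
Proof. by have [l fl] := close_exists f; exact: (xgetPex 0 (ex_intro _ l fl)). Qed.

Lemma PhiE m (f : C m) l : close f l -> Phi f = l.
Proof. exact/close_uniq/closePhi. Qed.

Lemma Phi1 m : Phi (one m) = 1.
Proof. exact/PhiE/close1. Qed.

Lemma PhiD m (f g : C m) : Phi (f + g) = Phi f + Phi g.
Proof. by apply: PhiE; apply: closeD; exact: closePhi. Qed.

Lemma PhiZ m c (f : C m) : Phi (c *: f) = c * Phi f.
Proof. by apply: PhiE; apply: closeZ; exact: closePhi. Qed.

Lemma Phi_ge0 m (f : C m) : (forall x, 0 <= f x) -> 0 <= Phi f.
Proof.
move=> f0; apply: (close_ge (closePhi f) (N := m)) => n _ mn x.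
by rewrite mul0r; apply: (ev_ge0 L_ge0).
Qed.

Lemma Phi_le m (f g : C m) : (forall x, f x <= g x) -> Phi f <= Phi g.
Proof.
move=> fg; rewrite -subr_ge0 -mulN1r -PhiZ -PhiD scaleN1r.
by apply: Phi_ge0 => x; rewrite CDE CNE subr_ge0.
Qed.

Lemma Phi_gt0 m f : Lam m f -> 0 < Phi f.
Proof. by move=> Kf; exact: close_Lam_gt0 Kf (closePhi f). Qed.

Lemma Phi_norm m (f : C m) : `|Phi f| <= `|f|.
Proof.
rewrite ler_norml; apply/andP; split.
  apply: (close_ge (closePhi f) (N := m)) => n _ mn x.
  by have := ev_norm f x mn; rewrite ler_norml mulNr => /andP[].
apply: (close_le (closePhi f) (N := m)) => n _ mn x.
by apply: le_trans (ler_norm _) _; exact: ev_norm.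
Qed.

Definition eigval n : R := Phi (L n (one n)).

Lemma Phi_ev1 m n f : m <= n -> Phi (ev L m n f) = Phi (ev L m n (one m)) * Phi f.
Proof. by move=> mn; apply/PhiE/close_push => //; exact: closePhi. Qed.

Lemma PhiL n (f : C n) : Phi (L n f) = eigval n * Phi f.
Proof. by rewrite /eigval -!ev1 Phi_ev1//; clear; lia. Qed.

Lemma eigval_bounds n : kappa^-1 <= eigval n <= kappa.
Proof.
have [_ [_ /(_ n)[hk _]] _ _] := hC2.
apply/andP; split.
  rewrite -[leLHS]mulr1 -(Phi1 (n + 1)) -PhiZ; apply: Phi_le => x.
  by rewrite CZE C1E mulr1; case/andP: (hk x).
rewrite -[leRHS]mulr1 -(Phi1 (n + 1)) -PhiZ; apply: Phi_le => x.
by rewrite CZE C1E mulr1; case/andP: (hk x).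
Qed.

Let kappa_ge1 : 1 <= kappa. Proof. by have [_ []] := hC2. Qed.
Let kappa_gt0 : 0 < kappa. Proof. exact: lt_le_trans kappa_ge1. Qed.

Lemma eigval_gt0 n : 0 < eigval n.
Proof.
by case/andP: (eigval_bounds n) => h _; apply: lt_le_trans h; rewrite invr_gt0.
Qed.

(** In particular [Phi] of an image is the denominator by which [h_n] is
    normalized. *)
Lemma Phi_ev m k n (e : m + k%:Z = n) (f : C m) :
  Phi (ev L m n f) = lambda_prod eigval m k * Phi f.
Proof.
case: n / e; elim: k => [|k IH].
  by rewrite addr0 ev_refl /lambda_prod big_geq// mul1r.
have -> : m + k.+1%:Z = m + k%:Z + 1 by clear; lia.
rewrite evS ?PhiL ?IH; last by clear; lia.
by rewrite /lambda_prod big_nat_recr//= mulrA [eigval _ * _]mulrC.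
Qed.

(** * Conformal measures *)

Definition eigmes n : finmeas (X n) :=
  sval (cid (riesz_representation (@PhiD n) (@PhiZ n) (@Phi_ge0 n))).

Lemma eigmesE n (f : C n) : pairing f (eigmes n) = Phi f.
Proof. by rewrite /eigmes; case: cid. Qed.

Lemma eigmes_Mspace n : Mspace (eigmes n).
Proof. by apply: Mspace_pairing1; rewrite eigmesE Phi1. Qed.

Lemma eigmes_setT n : eigmes n [set: borel (X n)] = 1%E.
Proof. by rewrite -[LHS]fineK ?fin_num_measure// -pairing1 eigmesE Phi1. Qed.

Lemma pairing_ev1_gt0 m n (sigma : finmeas (X n)) : m <= n -> Mspace sigma ->
  0 < pairing (ev L m n (one m)) sigma.
Proof.
move=> /ev1_ge_cst[c c0 hc] /pairing1_gt0 s0.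
apply: (@lt_le_trans _ _ (pairing (c *: one n) sigma)).
  by rewrite pairingZ mulr_gt0.
by apply: le_pairing => x; rewrite CZE C1E mulr1.
Qed.

Lemma pairing_ratio_between m n f g (sigma : finmeas (X n)) a b : m <= n ->
  Mspace sigma -> 0 < pairing (ev L m n g) sigma ->
  (forall x, a * ev L m n g x <= ev L m n f x <= b * ev L m n g x) ->
  a <= pairing (ev L m n f) sigma / pairing (ev L m n g) sigma <= b.
Proof.
move=> mn Ms w0 h; rewrite ler_pdivlMr// ler_pdivrMr// -!pairingZ.
by apply/andP; split; apply: le_pairing => x; rewrite CZE; case/andP: (h x).
Qed.

(** The pointwise bound defining [close] is integrated against [sigma]; it is
    homogeneous in the iterates of 1, so the threshold does not depend on [sigma]. *)
Lemma close_pairing m f l e : close f l -> 0 < e ->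
  exists N : int, forall n, N <= n -> m <= n ->
  forall sigma : finmeas (X n), Mspace sigma ->
  `|l - pairing (ev L m n f) sigma / pairing (ev L m n (one m)) sigma| <= e.
Proof.
move=> fl e0; have [N hN] := fl e e0; exists N => n Nn mn sigma Ms.
have w0 := pairing_ev1_gt0 mn Ms.
have := @pairing_ratio_between m n f (one m) sigma (l - e) (l + e) mn Ms w0.
rewrite distrC ler_distl; apply => x.
by have := hN n Nn mn x; rewrite ler_norml => /andP[h1 h2]; apply/andP; split; lra.
Qed.

Lemma pairing_dual_iterL n k (sigma : finmeas (X (n + k%:Z))) (f : C n) :
  Mspace sigma ->
  pairing f (dual (iterL L n k) sigma) = pairing (ev L n (n + k%:Z) f) sigma.
Proof.
move=> Ms; rewrite -iterL_ev; apply: (dualP _ Ms) => rho' Mr.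
have nk : n <= n + k%:Z by clear; lia.
have [mu Mmu muE] := dual_acts_ev hdual nk Mr.
by exists mu => // g; rewrite muE iterL_ev.
Qed.

Lemma lambda_ratioE n j (sigma : finmeas (X (n + j.+1%:Z))) :
  lambda_ratio L n j sigma =
  pairing (ev L (n + 1) (n + j.+1%:Z) (L n (one n))) sigma /
  pairing (ev L (n + 1) (n + j.+1%:Z) (one (n + 1))) sigma.
Proof.
rewrite /lambda_ratio iterL_ev iterL_next_ev -ev1 ev_comp//; clear; lia.
Qed.

Lemma eigenmeasure_cvg n (sigma : forall j : nat, finmeas (X (n + j%:Z))) :
  (forall j : nat, Mspace (sigma j)) ->
  [/\ lambda_ratio L n j (sigma j.+1) @[j --> \oo] --> eigval n,
     Mspace (eigmes n)
   & weakstar_cvg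
       (fun k : nat => normalize (dual (iterL L n k) (sigma k))) (eigmes n)].
Proof.
move=> Ms; split; first 2 [exact: eigmes_Mspace].
  apply/cvgrPdist_le => e e0.
  have [N hN] := close_pairing (closePhi (L n (one n))) e0.
  exists `|N - n|%N => // j /= jN; rewrite lambda_ratioE.
  apply: hN; last exact: Ms; move: jN; clear; lia.
move=> f; apply/cvgrPdist_le => e e0.
have [N hN] := close_pairing (closePhi f) e0.
exists `|N - n|%N => // k /= kN; rewrite pairing_normalize !pairing_dual_iterL//.
by rewrite eigmesE; apply: hN => //; move: kN; clear; lia.
Qed.

Lemma measure_eqZ_pairing n (mu nu : finmeas (X n)) (c : R) : 0 <= c ->
  (measure_eqZ mu c nu <-> forall f, pairing f mu = c * pairing f nu).
Proof.
move=> c0; pose cnu : finmeas (X n) := mscale (NngNum c0) nu.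
have E (f : C n) : pairing f cnu = c * pairing f nu.
  by rewrite /cnu {1}/pairing pairing_mscale.
split=> [h f|h A mA].
  by rewrite -E; apply: eq_pairing => A mA; rewrite h.
by rewrite (@measure_eq_pairing _ _ mu cnu)// => f; rewrite h E.
Qed.

Lemma pairing_dualL n (sigma : finmeas (X (n + 1))) (f : C n) : Mspace sigma ->
  pairing f (dual (L n) sigma) = pairing (L n f) sigma.
Proof. by move=> Ms; apply: (dualP _ Ms); exact: hdual. Qed.

Lemma eigmes_eigenmeasure n : [/\ 0 < eigval n, eigmes n [set: borel (X n)] = 1%E
  & measure_eqZ (dual (L n) (eigmes (n + 1))) (eigval n) (eigmes n)].
Proof.
split; [exact: eigval_gt0|exact: eigmes_setT|].
apply/measure_eqZ_pairing; first exact/ltW/eigval_gt0.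
move=> f; rewrite pairing_dualL ?eigmesE ?PhiL//; exact: eigmes_Mspace.
Qed.

(** By iteration of the relation, [m' n] is proportional to the pull-back of every
    later [m' p], and the normalized pull-backs converge to [eigmes n]. *)
Lemma eigenmeasures_eigmes_unique : eigenmeasures L eigmes /\
  forall m' : forall n : int, finmeas (X n), eigenmeasures L m' ->
  forall n : int, measure_eq (m' n) (eigmes n).
Proof.
split=> [n|m' em' n].
  by split; [exact: eigmes_setT|exists (eigval n); case: (eigmes_eigenmeasure n)].
have Mm' p : Mspace (m' p).
  by apply: Mspace_pairing1; rewrite pairing1 (em' p).1.
have evm' p : n <= p -> exists c, forall f : C n,
    pairing (ev L n p f) (m' p) = c * pairing f (m' n).
  move: p; apply: int_ge_ind; first by exists 1 => f; rewrite ev_refl mul1r.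
  move=> p np [c hc]; have [m'1 [d hd]] := em' p.
  have d0 : 0 <= d.
    rewrite -lee_fin; have := hd setT measurableT; rewrite m'1 mule1 => <-.
    exact: measure_ge0.
  have {}hd := (measure_eqZ_pairing _ _ d0).1 hd.
  exists (d * c) => f; rewrite evS// -pairing_dualL// hd hc mulrA.
  by [].
apply: measure_eq_pairing => f; rewrite eigmesE.
apply/esym/eqP; rewrite -subr_eq0 -normr_le0; apply/ler_addgt0Pr => e e0.
rewrite add0r; have [N hN] := close_pairing (closePhi f) e0.
have Np : N <= Num.max n N by rewrite le_max lexx orbT.
have np : n <= Num.max n N by rewrite le_max lexx.
have := hN _ Np np _ (Mm' _); have [c hc] := evm' _ np.
have w0 := pairing_ev1_gt0 np (Mm' _).
rewrite !hc in w0 *; rewrite pairing1 (em' n).1 mulr1 in w0 *.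
by rewrite [c * _]mulrC mulfK// gt_eqF.
Qed.

Lemma ln_dist_le (u v a b : R) : 0 < a -> a <= u <= b -> a <= v <= b ->
  `|ln u - ln v| <= (b - a) / a.
Proof.
move=> a0 /andP[au ub] /andP[av vb].
have u0 := lt_le_trans a0 au; have v0 := lt_le_trans a0 av.
have b0 := lt_le_trans u0 ub.
have lba : ln b - ln a <= (b - a) / a.
  rewrite -ln_div ?posrE//; have -> : b / a = 1 + (b - a) / a.
    by rewrite mulrBl divff ?gt_eqF// addrC subrK.
  apply: le_ln1Dx; apply: lt_le_trans (_ : 0 <= _); first by rewrite ltrN10.
  by rewrite divr_ge0 ?subr_ge0 ?(le_trans au ub)// ltW.
have := ler_ln a0 u0; have := ler_ln u0 b0; have := ler_ln a0 v0.
have := ler_ln v0 b0; rewrite au ub av vb => h1 h2 h3 h4.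
by rewrite ler_norml; apply/andP; split; lra.
Qed.

(** The limit and the quotient obtained from [sigma] lie in the same order
    interval, whose relative length is controlled by the contraction. *)
Lemma eigenmeasure_rate : exists C1 gamma : R, [/\ 0 < C1, 0 < gamma < 1,
   forall (n : int) (j : nat) (sigma : finmeas (X (n + j.+1%:Z))),
     (tau <= j.+1)%N -> Mspace sigma ->
     `|ln (eigval n) - ln (lambda_ratio L n j sigma)| <= C1 * gamma ^+ j.+1
 & forall (n : int) (k : nat) (sigma : finmeas (X (n + k%:Z)))
          (f : Cspace R (X n)),
     (tau <= k)%N -> Mspace sigma -> Lam n f ->
     `|pairing f (eigmes n) - pairing f (dual (iterL L n k) sigma) /
                         pairing (Cst1 (X n)) (dual (iterL L n k) sigma)|
       <= C1 * `|f| * gamma ^+ k].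
Proof.
pose K1 := (kappa - kappa^-1) / kappa^-1 / gam ^+ tau.
have kV : kappa^-1 <= kappa.
  by apply: le_trans kappa_ge1; rewrite invf_le1.
have K10 : 0 <= K1.
  rewrite /K1 !mulr_ge0// ?invr_ge0 ?exprn_ge0// ?subr_ge0// ?invr_ge0 ltW//.
have KK : K0 <= K0 / gam by rewrite ler_pdivlMr// ler_piMr// ltW.
exists (K0 / gam + K1), gam; split.
- by rewrite ltr_wpDr// divr_gt0.
- by rewrite gam_gt0.
- move=> n j sigma tj Ms; rewrite lambda_ratioE.
  have nj : n + 1 <= n + j.+1%:Z by clear; lia.
  have w0 := pairing_ev1_gt0 nj Ms.
  have [_ _ hr] := hrate.
  have LL : Lam (n + 1) (L n (one n)).
    by rewrite -ev1; apply: ev_Lam; [clear; lia|exact: Lam1].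
  (* from time n + 1 on only j steps remain: if j = tau - 1 the contraction has
     not started, and the bounds on L 1 take its place *)
  move: tj; rewrite leq_eqVlt => /predU1P[tj|tj].
    have [_ [_ /(_ n)[hk _]] _ _] := hC2.
    have := @pairing_ratio_between _ _ (L n (one n)) _ _ kappa^-1 kappa nj Ms w0 _.
    move=> hh; apply: le_trans (_ : K1 * gam ^+ j.+1 <= _).
      rewrite /K1 tj divfK ?expf_neq0 ?gt_eqF//; apply: ln_dist_le.
      - by rewrite invr_gt0.
      - exact: eigval_bounds.
      - apply: hh => x; rewrite -!CZE -!evZ//.
        by apply/andP; split; apply: leE => // y; rewrite CZE C1E mulr1;
          case/andP: (hk y).
    by rewrite ler_pM2r ?exprn_gt0// lerDr divr_ge0// ltW.
  have [a [b [a0 ab ba h]]] := hr (n + 1) j (L n (one n)) (one (n + 1)) tj LL (Lam1 _).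
  apply: le_trans (_ : (b - a) / a <= _); last first.
    rewrite ler_pdivrMr//; apply: le_trans ba _.
    apply: ler_wpM2r; first exact: ltW.
    apply: le_trans (_ : K0 / gam * gam ^+ j.+1 <= _).
      by rewrite exprS mulrA divfK ?gt_eqF.
    by rewrite ler_pM2r ?exprn_gt0// lerDl.
  apply: ln_dist_le => //.
    have fl := closePhi (L n (one n)).
    apply/andP; split.
      apply: (close_ge fl (N := n + 1 + j%:Z)) => p jp _ x.
      by case/andP: (h p jp x).
    apply: (close_le fl (N := n + 1 + j%:Z)) => p jp _ x.
    by case/andP: (h p jp x).
  apply: pairing_ratio_between => // x; apply: h; clear; lia.
- move=> n k sigma f tk Ms Kf; rewrite !pairing_dual_iterL// eigmesE.
  have nk : n <= n + k%:Z by clear; lia.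
  have w0 := pairing_ev1_gt0 nk Ms.
  have [_ _ /(_ n k f (one n) tk Kf (Lam1 n))[a [b [a0 ab ba h]]]] := hrate.
  have af : a <= `|f|.
    rewrite -(ler_pM2r (ev1_gt0 point nk)).
    have /andP[+ _] := h _ (lexx _) point; move=> /le_trans; apply.
    by apply: le_trans (ler_norm _) _; exact: ev_norm.
  have /andP[h1 h2] := pairing_ratio_between nk Ms w0 (h _ (lexx _)).
  have h3 : a <= Phi f.
    apply: (close_ge (closePhi f) (N := n + k%:Z)) => p jp _ x.
    by case/andP: (h p jp x).
  have h4 : Phi f <= b.
    apply: (close_le (closePhi f) (N := n + k%:Z)) => p jp _ x.
    by case/andP: (h p jp x).
  apply: (@le_trans _ _ (b - a)).
    by rewrite ler_norml; apply/andP; split; lra.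
  apply: le_trans ba _; rewrite mulrAC; apply: ler_wpM2r.
    by rewrite exprn_ge0// ltW.
  apply: ler_pM => //; [exact: ltW|exact: ltW|].
  by rewrite (le_trans KK)// lerDl.
Qed.

(** * Equivariant functions *)

Let D := M * expR Delta.
Let D_gt0 : 0 < D. Proof. by rewrite mulr_gt0// expR_gt0. Qed.

(** After [tau] steps, an image is comparable in the cone order, hence pointwise,
    to the image of 1, whose oscillation is bounded by hypothesis. *)
Lemma ev_oscillation m n f : m + tau%:Z <= n -> Lam m f ->
  forall x y, ev L m n f x <= D * ev L m n f y.
Proof.
move=> mn Kf x y; have [p [pE mp]] : exists p, n = p + tau%:Z /\ m <= p.
  by exists (n - tau%:Z); split; lia.
move: x y; rewrite {}pE in mn * => x y.
have pp : p <= p + tau%:Z by clear; lia.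
rewrite -(ev_comp L f mp pp).
have [a a0 [h1 h2]] := tau_comparable (lexx _) (ev_Lam mp Kf) (Lam1 p).
have := cone_le_pointwise (@Lam_Cplus _) h1 y.
have := cone_le_pointwise (@Lam_Cplus _) h2 x; rewrite !CZE => h3 h4.
have [_ _ _ /(_ p)[_]] := hC2; rewrite iterL_ev.
set T := ev L p _ (one p) in h3 h4 * => sT.
have xT : T x <= sup (range T).
  apply: ub_le_sup; last by exists x.
  by exists `|T| => _ [z _ <-]; apply: le_trans (ler_norm _) _; exact: le_sup_norm.
have yT : inf (range T) <= T y.
  apply: ge_inf; last by exists y.
  by exists 0 => _ [z _ <-]; rewrite ltW// ev1_gt0.
apply: le_trans h3 _; rewrite /D -!mulrA; apply: ler_wpM2l; first exact: ltW.
apply: (@le_trans _ _ (a * (expR Delta * T y))).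
  apply: ler_wpM2l; first exact: ltW.
  by apply: le_trans xT _; apply: le_trans sT _; rewrite ler_pM2l ?expR_gt0.
by rewrite mulrCA ler_pM2l ?expR_gt0.
Qed.

Definition normal_ev m n (f : C m) : C n := (Phi (ev L m n f))^-1 *: ev L m n f.
Arguments normal_ev : clear implicits.

Lemma Phi_ev_gt0 m n f : m <= n -> Lam m f -> 0 < Phi (ev L m n f).
Proof. by move=> mn Kf; exact/Phi_gt0/ev_Lam. Qed.

Lemma Phi_normal_ev m n f : m <= n -> Lam m f -> Phi (normal_ev m n f) = 1.
Proof. by move=> mn Kf; rewrite PhiZ mulVf// gt_eqF// Phi_ev_gt0. Qed.

Lemma Lam_normal_ev m n f : m <= n -> Lam m f -> Lam n (normal_ev m n f).
Proof.
move=> mn Kf; apply: (coneZ_gt0 (Lam_cone n)); last exact: ev_Lam.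
by rewrite invr_gt0 Phi_ev_gt0.
Qed.

(** [Phi] is an average, so 1 lies between the infimum and the supremum of the
    function, and these differ at most by the factor [D]. *)
Lemma normal_ev_bounds m n f : m + tau%:Z <= n -> Lam m f ->
  forall x, D^-1 <= normal_ev m n f x <= D.
Proof.
move=> mn Kf x; have mn' : m <= n by apply: le_trans mn; clear; lia.
have Pu := Phi_normal_ev mn' Kf; set u := normal_ev m n f in Pu *.
have osc y z : u y <= D * u z.
  rewrite /u !CZE mulrCA ler_pM2l ?invr_gt0 ?Phi_ev_gt0//.
  exact: ev_oscillation.
apply/andP; split.
  rewrite -div1r ler_pdivrMr// mulrC -Pu -[leRHS]mulr1 -(Phi1 n) -PhiZ.
  by apply: Phi_le => y; rewrite [leRHS]CZE C1E mulr1.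
rewrite -[leRHS]mulr1 -Pu -PhiZ -[leLHS]mulr1 -(Phi1 n) -PhiZ.
by apply: Phi_le => y; rewrite [leRHS]CZE [leLHS]CZE C1E mulr1.
Qed.

(** Both sides have [Phi] equal to 1, hence the constants of the order interval
    between them straddle 1 and its relative length bounds their distance. *)
Lemma normal_ev_dist p m (k : nat) n f g : p <= m -> n = m + k%:Z ->
  (tau <= k)%N -> Lam m f -> Lam p g ->
  forall x, `|normal_ev p n g x - normal_ev m n f x| <= K0 * gam ^+ k * D.
Proof.
move=> pm nE tk Kf Kg x.
have mn : m <= n by rewrite nE; clear; lia.
have pn : p <= n := le_trans pm mn.
have mtn : m + tau%:Z <= n by rewrite nE; move: tk; clear; lia.
have [_ _ /(_ m k _ f tk (ev_Lam pm Kg) Kf)[a [b [a0 ab ba h]]]] := hrate.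
have {}h y : a * ev L m n f y <= ev L p n g y <= b * ev L m n f y.
  by rewrite -(ev_comp L g pm mn); apply: h; rewrite nE.
have P1 : a * Phi (ev L m n f) <= Phi (ev L p n g).
  by rewrite -PhiZ; apply: Phi_le => y; rewrite CZE; case/andP: (h y).
have P2 : Phi (ev L p n g) <= b * Phi (ev L m n f).
  by rewrite -PhiZ; apply: Phi_le => y; rewrite CZE; case/andP: (h y).
have Pf := Phi_ev_gt0 mn Kf; have Pg := Phi_ev_gt0 pn Kg.
have /andP[u0 uD] := normal_ev_bounds mtn Kf x.
have b0 : 0 < b := lt_le_trans a0 ab.
move: u0 uD; rewrite /normal_ev !CZE; move: (h x) P1 P2 Pf Pg.
set u := ev L m n f x; set v := ev L p n g x.
set s := Phi (ev L m n f); set t := Phi (ev L p n g).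
move=> /andP[h1 h2] P1 P2 s0 t0 u0 uD.
have su0 : 0 < s^-1 * u by apply: lt_le_trans u0; rewrite invr_gt0.
have u00 : 0 < u by move: su0; rewrite pmulr_rgt0// invr_gt0.
apply: (@le_trans _ _ ((b / a - 1) * (s^-1 * u))); last first.
  apply: ler_pM => //; rewrite ?subr_ge0 ?ler_pdivlMr ?mul1r//; first exact: ltW.
  by rewrite lerBlDr ler_pdivrMr// mulrDl mul1r -lerBlDr.
have up : t^-1 * v <= b / a * (s^-1 * u).
  rewrite [leLHS]mulrC ler_pdivrMr//; apply: le_trans h2 _.
  have -> : b / a * (s^-1 * u) * t = (b * u) * (t / (a * s)).
    by field; rewrite !gt_eqF.
  apply: ler_peMr; first by rewrite mulr_ge0// ltW.
  by rewrite ler_pdivlMr ?mulr_gt0// mul1r.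
have lo : a / b * (s^-1 * u) <= t^-1 * v.
  rewrite [leRHS]mulrC ler_pdivlMr//; apply: le_trans h1.
  have -> : a / b * (s^-1 * u) * t = (a * u) * (t / (b * s)).
    by field; rewrite !gt_eqF.
  apply: ler_piMr; first by rewrite mulr_ge0// ltW.
  by rewrite ler_pdivrMr ?mulr_gt0// mul1r.
(* so that 1 - a / b <= b / a - 1: the upper deviation is the larger one *)
have abba : 2 <= a / b + b / a.
  have -> : a / b + b / a = 2 + (b - a) ^+ 2 / (a * b).
    by field; rewrite !gt_eqF.
  by rewrite lerDl divr_ge0 ?sqr_ge0// mulr_ge0 ?ltW.
have := ler_wpM2r (ltW su0) abba.
by rewrite ler_norml => h3; apply/andP; split; lra.
Qed.

Let rate (k : nat) := K0 * gam ^+ k * D.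

Let rate_mono j k : (j <= k)%N -> rate k <= rate j.
Proof.
move=> jk; rewrite ler_pM2r// ler_pM2l//; apply: ler_wiXn2l => //; exact: ltW.
Qed.

Let rate_cvg (c e : R) : 0 <= c -> 0 < e ->
  exists2 k0, (tau <= k0)%N & forall k, (k0 <= k)%N -> c * rate k <= e.
Proof.
move=> c0 e0; have [k0 tk0 h] := rate_small (c * K0 * D) e0.
exists k0 => // k k0k; apply: le_trans (ler_wpM2l c0 (rate_mono k0k)) _.
by apply/ltW/(le_lt_trans _ h); rewrite /rate le_eqVlt; apply/predU1P; left; ring.
Qed.

Lemma eigfun_exists n : exists h : C n, forall k, (tau <= k)%N ->
  forall x, `|h x - normal_ev (n - k%:Z) n (one _) x| <= rate k.
Proof.
apply: uniform_cauchy_lim => [j k /andP[tk kj] x|e e0].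
  apply: normal_ev_dist => //; try exact: Lam1; last by clear; lia.
  by move: kj; clear; lia.
have [k tk h] := rate_cvg (ler01 : 0 <= 1 :> R) e0.
by exists k => //; have := h k (leqnn _); rewrite mul1r.
Qed.

Definition eigfun n : C n := sval (cid (eigfun_exists n)).

Lemma eigfun_dist m (k : nat) n f : n = m + k%:Z -> (tau <= k)%N -> Lam m f ->
  `|eigfun n - normal_ev m n f| <= 2 * rate k.
Proof.
move=> nE tk Kf; apply: sup_norm_le => x; rewrite CDE CNE.
have mE : m = n - k%:Z by rewrite nE; clear; lia.
have := svalP (cid (eigfun_exists n)) k tk x.
have := @normal_ev_dist _ _ _ _ f (one _) (lexx m) nE tk Kf (Lam1 _) x.
rewrite -/(eigfun n) -mE -/(rate k) !ler_norml => /andP[? ?] /andP[? ?].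
by apply/andP; split; lra.
Qed.

Lemma normal_evE n k (f : C (n - k%:Z)) :
  (lambda_prod eigval (n - k%:Z) k * pairing f (eigmes (n - k%:Z)))^-1
    *: iterL_to L n k f = normal_ev (n - k%:Z) n f.
Proof. by rewrite iterL_to_ev eigmesE -(Phi_ev (subrK k%:Z n)). Qed.

Lemma eigenfunction_cvg n (f : forall k : nat, C (n - k%:Z)) :
  (forall k : nat, Lam (n - k%:Z) (f k)) ->
  (lambda_prod eigval (n - k%:Z) k * pairing (f k) (eigmes (n - k%:Z)))^-1
    *: iterL_to L n k (f k) @[k --> \oo] --> eigfun n.
Proof.
move=> Kf; apply/cvgrPdist_le => e e0.
have [k0 tk0 h] := rate_cvg (ler0n R 2) e0.
exists k0 => // k /= k0k; rewrite normal_evE; apply: le_trans (h k k0k).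
apply: eigfun_dist => //; first by clear; lia.
exact: leq_trans k0k.
Qed.

Lemma eigenfunction_rate : exists C2 gamma : R, [/\ 0 < C2, 0 < gamma < 1
  & forall (n : int) (k : nat) (f : C (n - k%:Z)),
      (tau <= k)%N -> Lam (n - k%:Z) f ->
      `|eigfun n - (lambda_prod eigval (n - k%:Z) k * pairing f (eigmes (n - k%:Z)))^-1
                *: iterL_to L n k f| <= C2 * gamma ^+ k].
Proof.
exists (2 * K0 * D), gam; split.
- by rewrite mulr_gt0// mulr_gt0.
- by rewrite gam_gt0.
move=> n k f tk Kf.
rewrite normal_evE; apply: le_trans (eigfun_dist _ tk Kf) _; first by clear; lia.
by rewrite /rate le_eqVlt; apply/predU1P; left; ring.
Qed.

Lemma eigfun_approx n (e : R) : 0 < e -> exists2 k, (tau <= k)%N &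
  forall m f, n = m + k%:Z -> Lam m f -> `|eigfun n - normal_ev m n f| <= e.
Proof.
move=> e0; have [k tk h] := rate_cvg (ler0n R 2) e0.
exists k => // m f nE Kf; apply: le_trans (h k (leqnn _)).
exact: eigfun_dist.
Qed.

Lemma eigfun_gt0 n x : 0 < eigfun n x.
Proof.
have e0 : 0 < D^-1 / 2 by rewrite divr_gt0 ?invr_gt0.
have [k tk h] := eigfun_approx n e0.
have nE : n = n - k%:Z + k%:Z by clear; lia.
have mn : n - k%:Z + tau%:Z <= n by move: tk; clear; lia.
have := h _ _ nE (Lam1 _).
have /andP[+ _] := normal_ev_bounds mn (Lam1 _) x.
have := le_sup_norm (eigfun n - normal_ev (n - k%:Z) n (one _)) x.
rewrite CDE CNE => h1 h2 h3; have := le_trans h1 h3.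
by rewrite ler_norml => /andP[+ _]; lra.
Qed.

(** A limit of elements of the cone is in the cone or 0, and strict positivity
    excludes 0. *)
Lemma eigfun_Lam n : Lam n (eigfun n).
Proof.
have [[_ clK] _ _] := @hC1 n.
have [//|/= h0] : (Lam n `|` [set 0]) (eigfun n); last first.
  by have := @eigfun_gt0 n point; rewrite h0 ltxx.
apply: clK => B /nbhs_ballP[e /= e0 eB].
have e20 : 0 < e / 2 by rewrite divr_gt0.
have [k tk h] := eigfun_approx n e20.
have nE : n = n - k%:Z + k%:Z by clear; lia.
exists (normal_ev (n - k%:Z) n (one _)); split.
  by left; apply: Lam_normal_ev; [clear; lia|exact: Lam1].
apply: eB; rewrite -ball_normE /ball_/=; apply: le_lt_trans (h _ _ nE (Lam1 _)) _.
by rewrite ltr_pdivrMr// ltr_pMr// ltr1n.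
Qed.

Lemma Phi_eigfun n : Phi (eigfun n) = 1.
Proof.
apply/eqP; rewrite -subr_eq0 -normr_le0; apply/ler_addgt0Pr => e e0; rewrite add0r.
have [k tk h] := eigfun_approx n e0.
have nE : n = n - k%:Z + k%:Z by clear; lia.
apply: le_trans (h _ _ nE (Lam1 _)).
have kn : n - k%:Z <= n by clear; lia.
rewrite -[X in Phi _ - X](Phi_normal_ev kn (Lam1 _)) -mulN1r -PhiZ -PhiD scaleN1r.
exact: Phi_norm.
Qed.

Lemma L_normal_ev m n f : m <= n ->
  L n (normal_ev m n f) = eigval n *: normal_ev m (n + 1) f.
Proof.
move=> mn; rewrite /normal_ev linearZ/= evS// PhiL invfM scalerA mulrA.
by rewrite divff ?mul1r// gt_eqF// eigval_gt0.
Qed.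

(** [L n] maps normalized images to [eigval n] times normalized images, and is
    bounded because it is positive and [L n 1 <= kappa]. *)
Lemma L_eigfun n : L n (eigfun n) = eigval n *: eigfun (n + 1).
Proof.
apply/eqP; rewrite -subr_eq0 -normr_le0; apply/ler_addgt0Pr => e e0; rewrite add0r.
pose d := e / (2 * kappa).
have d0 : 0 < d by rewrite divr_gt0 ?mulr_gt0.
have [k0 tk0 h] := rate_cvg (ler0n R 2) d0.
have nE : n = n - k0%:Z + k0%:Z by clear; lia.
have nE' : n + 1 = n - k0%:Z + k0.+1%:Z by clear; lia.
have kn : n - k0%:Z <= n by clear; lia.
have h1 := le_trans (eigfun_dist nE tk0 (Lam1 _)) (h _ (leqnn _)).
have h2 := le_trans (eigfun_dist nE' (leqW tk0) (Lam1 _)) (h _ (leqnSn _)).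
set v := normal_ev _ n _ in h1; set w := normal_ev _ _ _ in h2.
have Lv : L n v = eigval n *: w by rewrite L_normal_ev.
have -> : L n (eigfun n) - eigval n *: eigfun (n + 1) =
    L n (eigfun n - v) - eigval n *: (eigfun (n + 1) - w).
  by rewrite linearB Lv scalerBr opprB addrA subrK.
apply: le_trans (ler_normB _ _) _; rewrite normrZ.
have /andP[_ lk] := eigval_bounds n.
have h3 : `|L n (eigfun n - v)| <= kappa * d.
  have [_ [_ /(_ n)[hk _]] _ _] := hC2.
  apply: sup_norm_le => x; rewrite -ev1.
  have n1 : n <= n + 1 by clear; lia.
  apply: le_trans (ev_norm _ _ n1) _; rewrite mulrC; apply: ler_pM => //.
    by rewrite ltW// ev1_gt0.
  by rewrite ev1; case/andP: (hk x).
have h4 : `|eigval n| * `|eigfun (n + 1) - w| <= kappa * d.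
  by rewrite gtr0_norm ?eigval_gt0//; apply: ler_pM => //; rewrite ltW// eigval_gt0.
have : kappa * d + kappa * d = e by rewrite /d; field; rewrite gt_eqF.
move: h3 h4; lra.
Qed.

(** Applying [Phi] identifies the scalar as [eigval n]; then [h' n] is the normalized
    image of each earlier [h' m], hence arbitrarily close to [eigfun n]. *)
Lemma eigenfunctions_eigfun_unique : eigenfunctions L Lam eigmes eigfun /\
  forall h' : forall n : int, C n,
    eigenfunctions L Lam eigmes h' -> forall n : int, h' n = eigfun n.
Proof.
split=> [n|h' eh' n].
  split; [exact: eigfun_Lam|by rewrite eigmesE Phi_eigfun|].
  by exists (eigval n); exact: L_eigfun.
have K' p : Lam p (h' p) by case: (eh' p).
have P' p : Phi (h' p) = 1 by rewrite -eigmesE; case: (eh' p).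
have L' p : L p (h' p) = eigval p *: h' (p + 1).
  have [_ _ [c hc]] := eh' p; rewrite hc; congr (_ *: _).
  by have := congr1 (@Phi _) hc; rewrite PhiL PhiZ !P' !mulr1.
have N' m p : m <= p -> exists c, ev L m p (h' m) = c *: h' p.
  move: p; apply: int_ge_ind; first by exists 1; rewrite ev_refl scale1r.
  move=> p mp [c hc]; exists (c * eigval p).
  by rewrite evS// hc linearZ/= L' scalerA.
have E m : m <= n -> normal_ev m n (h' m) = h' n.
  move=> mn; rewrite /normal_ev; have [c hc] := N' m n mn.
  have := Phi_ev_gt0 mn (K' m); rewrite hc PhiZ P' mulr1 => c0.
  by rewrite scalerA mulVf ?scale1r// gt_eqF.
apply/esym/eqP; rewrite -subr_eq0 -normr_le0; apply/ler_addgt0Pr => e e0.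
rewrite add0r; have [k tk h] := eigfun_approx n e0.
have nE : n = n - k%:Z + k%:Z by clear; lia.
have kn : n - k%:Z <= n by clear; lia.
by have := h _ _ nE (K' _); rewrite E.
Qed.

End dynamics.

(** * Exponential convergence to the conformal measures and equivariant functions *)

Theorem theorem2p7 (R : realType) (X : int -> compactMetricType R)
    (L : forall n : int, {linear Cspace R (X n) -> Cspace R (X (n + 1))})
    (Lam : forall n : int, set (Cspace R (X n)))
    (kappa Delta : R) (tau : nat)
    (hdual : forall n : int, dual_acts_on_measures (L n))
    (hC1 : condC1 Lam) (hC2 : condC2 L Lam kappa Delta tau)
    (hC3 : condC3 L Lam) :
  exists (lam : int -> R) (m : forall n : int, finmeas (X n))
         (h : forall n : int, Cspace R (X n)),
    (* [A] *)
    (forall (n : int) (sigma : forall j : nat, finmeas (X (n + j%:Z))),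
       (forall j : nat, Mspace (sigma j)) ->
       [/\ lambda_ratio L n j (sigma j.+1) @[j --> \oo] --> lam n,
           Mspace (m n)
         & weakstar_cvg
             (fun k : nat => normalize (dual (iterL L n k) (sigma k))) (m n)])
    /\
    (* [B] *)
    (forall n : int,
       [/\ 0 < lam n,
           m n [set: borel (X n)] = 1%E
         & measure_eqZ (dual (L n) (m (n + 1))) (lam n) (m n)])
    /\
    (* [C] *)
    (eigenmeasures L m /\
     forall m' : forall n : int, finmeas (X n),
       eigenmeasures L m' -> forall n : int, measure_eq (m' n) (m n))
    /\
    (* [D] *)
    (exists C1 gamma : R, [/\ 0 < C1, 0 < gamma < 1,
       (* k = j + 1 *)
       forall (n : int) (j : nat) (sigma : finmeas (X (n + j.+1%:Z))),
         (tau <= j.+1)%N -> Mspace sigma ->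
         `|ln (lam n) - ln (lambda_ratio L n j sigma)| <= C1 * gamma ^+ j.+1
     & forall (n : int) (k : nat) (sigma : finmeas (X (n + k%:Z)))
              (f : Cspace R (X n)),
         (tau <= k)%N -> Mspace sigma -> Lam n f ->
         `|pairing f (m n) - pairing f (dual (iterL L n k) sigma) /
                             pairing (Cst1 (X n)) (dual (iterL L n k) sigma)|
           <= C1 * `|f| * gamma ^+ k])
    /\
    (* [E] *)
    (forall (n : int) (f : forall k : nat, Cspace R (X (n - k%:Z))),
       (forall k : nat, Lam (n - k%:Z) (f k)) ->
       (lambda_prod lam (n - k%:Z) k * pairing (f k) (m (n - k%:Z)))^-1
         *: iterL_to L n k (f k) @[k --> \oo] --> h n)
    /\
    (* [F] *)
    (forall n : int,
       [/\ forall x : X n, 0 < h n x,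
           Lam n (h n),
           pairing (h n) (m n) = 1
         & L n (h n) = lam n *: h (n + 1)])
    /\
    (* [G] *)
    (eigenfunctions L Lam m h /\
     forall h' : forall n : int, Cspace R (X n),
       eigenfunctions L Lam m h' -> forall n : int, h' n = h n)
    /\
    (* [H] *)
    (exists C2 gamma : R, [/\ 0 < C2, 0 < gamma < 1
     & forall (n : int) (k : nat) (f : Cspace R (X (n - k%:Z))),
         (tau <= k)%N -> Lam (n - k%:Z) f ->
         `|h n - (lambda_prod lam (n - k%:Z) k * pairing f (m (n - k%:Z)))^-1
                   *: iterL_to L n k f| <= C2 * gamma ^+ k]).
Proof.
have [K0 [gam rate]] := contraction_rate_exists hC1 hC2.
exists (eigval L), (eigmes hdual hC1 hC2 hC3 rate), (eigfun hdual hC1 hC2 hC3 rate).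
split; first exact: eigenmeasure_cvg.
split; first exact: eigmes_eigenmeasure.
split; first exact: eigenmeasures_eigmes_unique.
split; first exact: eigenmeasure_rate.
split; first exact: eigenfunction_cvg.
split.
  move=> n; split.
  - exact: eigfun_gt0.
  - exact: eigfun_Lam.
  - by rewrite eigmesE Phi_eigfun.
  - exact: L_eigfun.
by split; [exact: eigenfunctions_eigfun_unique|exact: eigenfunction_rate].
Qed.
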